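(* Let $M$ be a smooth oriented $3$-dimensional manifold with a smooth volume form $\Omega$, let $X$ be a smooth divergence-free vector field on $(M,\Omega)$, and let $F:M\to\mathbb{R}$ be a smooth integral of $X$, i.e. $dF(X)\equiv 0$. Let $\Sigma$ be a compact connected component of a level $\{F=c_0\}$ such that $dF\neq 0$ at every point of $\Sigma$ and $X$ has no zeros on $\Sigma$. Let a smooth Riemannian metric be given on a neighborhood of $\Sigma$ in $M$. Then a smooth field $n$ of normal vectors along $\Sigma$ can be chosen in such a way that, with $\omega_n$ the $2$-form on $\Sigma$ given by $\omega_n(\xi,\eta)=\Omega(n(x),\xi,\eta)$ for $x\in\Sigma$, $\xi,\eta\in T_x\Sigma$: (i) the $2$-form $\omega_n$ on $\Sigma$ is nondegenerate; (ii) the flow $\varphi^t_\Sigma$ on $\Sigma$ defined by the restriction of $X$ to $\Sigma$ preserves $\omega_n$: $(\varphi^t_\Sigma)^*\omega_n=\omega_n$ for all $t$.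
   Context: All objects are $C^\infty$. The divergence of $X$ is defined by $L_X\Omega=(\operatorname{div}X)\,\Omega$; $X$ is divergence-free if $\operatorname{div}X\equiv 0$. Since $dF(X)\equiv0$, $X$ is tangent to $\Sigma$, so $X$ restricts to a vector field on the compact surface $\Sigma$ and generates a flow there. ''Normal'' means orthogonal to $T_x\Sigma$ with respect to the given Riemannian metric. *)

(* Defs.v *)
From HB Require Import structures.
From mathcomp Require Import all_boot all_order all_algebra.
From mathcomp Require Import all_classical all_reals all_analysis.

Set Implicit Arguments.
Unset Strict Implicit.
Unset Printing Implicit Defensive.
Import Order.TTheory GRing.Theory Num.Theory.
Import numFieldNormedType.Exports.
Local Open Scope classical_set_scope.
Local Open Scope ring_scope.

(* C^k and C^infinity maps on a set U, which is meant to be open. In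
   infinite dimension this would not be the usual notion. *)
Fixpoint Ck_on (R : realType) (V W : normedModType R) (k : nat)
    (U : set V) (f : V -> W) : Prop :=
  match k with
  | 0 => forall x, U x -> {for x, continuous f}
  | k'.+1 => (forall x, U x -> differentiable f x) /\
             (forall v, Ck_on k' U ('D_v f))
  end.

Definition smooth_on (R : realType) (V W : normedModType R)
    (U : set V) (f : V -> W) : Prop :=
  forall k, Ck_on k U f.

Record chart (R : realType) (n : nat) (T : topologicalType) := Chart {
  cdom : set T ;
  cmap : T -> 'rV[R]_n ;
  cinv : 'rV[R]_n -> T ;
  cdom_open : open cdom ;
  cimg_open : open (cmap @` cdom) ;
  cmapK : forall x, cdom x -> cinv (cmap x) = x ;
  cmap_cont : forall x, cdom x -> {for x, continuous cmap} ;
  cinv_cont : forall u, (cmap @` cdom) u -> {for u, continuous cinv} }.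

(* The smooth structure is generated by the atlas {chart_at p | p}, in which a
   preferred chart has been selected around each point. The tangent space
   T_p M is 'rV[R]_n: a tangent vector at p is given by its coordinates in the
   preferred chart chart_at p. *)
Record manifold (R : realType) (n : nat) := Manifold {
  mcarrier :> topologicalType ;
  chart_at : mcarrier -> chart R n mcarrier ;
  mem_chart_at : forall p, cdom (chart_at p) p ;
  chart_compat : forall p q,
    smooth_on (cmap (chart_at p) @` (cdom (chart_at p) `&` cdom (chart_at q)))
              (cmap (chart_at q) \o cinv (chart_at p)) ;
  manifold_hausdorff : hausdorff_space mcarrier ;
  manifold_second_countable : @second_countable mcarrier }.

Section Manifold.
Context {R : realType} {n : nat} {M : manifold R n}.
Implicit Types (p q x : M) (U W S : set M).

Definition dom p : set M := cdom (chart_at p).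
Definition coord p : M -> 'rV[R]_n := cmap (chart_at p).
Definition param p : 'rV[R]_n -> M := cinv (chart_at p).
Definition transition p q : 'rV[R]_n -> 'rV[R]_n := coord q \o param p.

(* Components in the chart at p of the tangent vector v at x, and conversely
   the tangent vector at x with components v in the chart at p. *)
Definition tcoord p x (v : 'rV[R]_n) : 'rV[R]_n :=
  'd (transition x p) (coord x x) v.
Definition tvec p x (v : 'rV[R]_n) : 'rV[R]_n :=
  'd (transition p x) (coord p x) v.

Definition smooth_fun (F : M -> R) : Prop :=
  forall p, smooth_on (coord p @` dom p) (F \o param p).

(* dF_p(v) *)
Definition dfun (F : M -> R) p (v : 'rV[R]_n) : R :=
  'd (F \o param p) (coord p p) v.

Definition field_in p (X : M -> 'rV[R]_n) (u : 'rV[R]_n) : 'rV[R]_n :=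
  tcoord p (param p u) (X (param p u)).

Definition smooth_field U (X : M -> 'rV[R]_n) : Prop :=
  forall p, smooth_on (coord p @` (dom p `&` U)) (field_in p X).

Definition smooth_field_along S (X : M -> 'rV[R]_n) : Prop :=
  forall p, S p -> exists U (Y : M -> 'rV[R]_n),
    [/\ open U, U p, smooth_field U Y & forall q, U q -> S q -> X q = Y q].

Definition metric_in p (g : M -> 'rV[R]_n -> 'rV[R]_n -> R)
    (u v w : 'rV[R]_n) : R :=
  g (param p u) (tvec p (param p u) v) (tvec p (param p u) w).

Definition riemannian_metric U (g : M -> 'rV[R]_n -> 'rV[R]_n -> R) : Prop :=
  [/\ forall p, U p -> forall v, scalar (g p v),
      forall p, U p -> forall v w, g p v w = g p w v,
      forall p, U p -> forall v, v != 0 -> 0 < g p v v &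
      forall p v w,
        smooth_on (coord p @` (dom p `&` U)) (fun u => metric_in p g u v w)].

Definition form3_in p (Om : M -> 'rV[R]_n -> 'rV[R]_n -> 'rV[R]_n -> R)
    (u v w z : 'rV[R]_n) : R :=
  let x := param p u in Om x (tvec p x v) (tvec p x w) (tvec p x z).

Definition smooth_3form
    (Om : M -> 'rV[R]_n -> 'rV[R]_n -> 'rV[R]_n -> R) : Prop :=
  [/\ forall p v w,
        [/\ scalar (Om p v w), scalar (fun z => Om p v z w)
          & scalar (fun z => Om p z v w)],
      forall p v w, [/\ Om p v v w = 0, Om p v w v = 0 & Om p w v v = 0] &
      forall p v w z,
        smooth_on (coord p @` dom p) (fun u => form3_in p Om u v w z)].

(* (L_X Om)_p(v, w, z), by the coordinate formula in the chart at p: with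
   v, w, z extended as coordinate (constant) fields,
     X(Om(v,w,z)) - Om([X,v],w,z) - Om(v,[X,w],z) - Om(v,w,[X,z]),
   where [X,v] = - D_v X. *)
Definition lie_derivative3 (X : M -> 'rV[R]_n)
    (Om : M -> 'rV[R]_n -> 'rV[R]_n -> 'rV[R]_n -> R) p
    (v w z : 'rV[R]_n) : R :=
  let u0 := coord p p in
  let Xp := field_in p X in
  let Omp := form3_in p Om in
  'd (fun u => Omp u v w z : R) u0 (Xp u0)
  + Omp u0 ('D_v Xp u0) w z + Omp u0 v ('D_w Xp u0) z
  + Omp u0 v w ('D_z Xp u0).

(* Smooth maps into M from an open subset U of a normed space. *)
Definition smooth_map_to (V : normedModType R) (U : set V) (f : V -> M) :
    Prop :=
  (forall a, U a -> {for a, continuous f}) /\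
  (forall p, smooth_on (U `&` f @^-1` dom p) (coord p \o f)).

Definition velocity (c : R -> M) (t : R) : 'rV[R]_n :=
  derive1 (coord (c t) \o c) t.

Definition curve_through S p (c : R -> M) : Prop :=
  exists J : set R, [/\ open J, J 0, smooth_map_to J c, c 0 = p &
    forall t, J t -> S (c t)].

(* For S an embedded submanifold of M: the subspace T_p S of T_p M. *)
Definition tangent S p : set 'rV[R]_n :=
  [set v | exists c, curve_through S p c /\ velocity c 0 = v].

(* The differential at p of a map f : S -> S (the values of f off S being
   irrelevant), v = c'(0) being sent to (f o c)'(0). For f smooth on S and v
   tangent to S this does not depend on the curve c. *)
Definition tangent_map S (f : M -> M) p (v : 'rV[R]_n) : 'rV[R]_n :=
  velocity
    (f \o xget (fun=> p) [set c | curve_through S p c /\ velocity c 0 = v]) 0.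

Definition pullback2 S (f : M -> M) (om : M -> 'rV[R]_n -> 'rV[R]_n -> R)
    p (v w : 'rV[R]_n) : R :=
  om (f p) (tangent_map S f p v) (tangent_map S f p w).

Definition nondegenerate_on S (om : M -> 'rV[R]_n -> 'rV[R]_n -> R) : Prop :=
  forall p, S p -> forall v, tangent S p v ->
    (forall w, tangent S p w -> om p v w = 0) -> v = 0.

(* phi : R x S -> S is smooth as a map on a subset: near each point it is the
   restriction of a smooth map on an open set of R x M. *)
Definition smooth_family_on S (phi : R -> M -> M) : Prop :=
  forall t p, S p -> exists (U : set (R * 'rV[R]_n)%type)
                            (Phi : R * 'rV[R]_n -> M),
    [/\ open U, U (t, coord p p), smooth_map_to U Phi &
        forall s q, S q -> dom p q -> U (s, coord p q) ->
          phi s q = Phi (s, coord p q)].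

(* phi is the (complete) flow on S of the vector field X tangent to S. *)
Definition flow_on S (X : M -> 'rV[R]_n) (phi : R -> M -> M) : Prop :=
  [/\ forall t p, S p -> S (phi t p),
      forall p, S p -> phi 0 p = p,
      forall s t p, S p -> phi (s + t) p = phi s (phi t p),
      smooth_family_on S phi &
      forall t p, S p -> velocity (fun s => phi s p) t = X (phi t p)].

Definition component_of (L S : set M) : Prop :=
  exists2 p, L p & S = connected_component L p.

End Manifold.

Definition oriented (R : realType) (n : nat) (M : manifold R n) : Prop :=
  forall p q x : M, dom p x -> dom q x ->
    0 < \det (jacobian (transition p q) (coord p x)).

Definition volume_form (R : realType) (M : manifold R 3)
    (Om : M -> 'rV[R]_3 -> 'rV[R]_3 -> 'rV[R]_3 -> R) : Prop :=
  smooth_3form Om /\ forall p, exists v w z, Om p v w z != 0.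

(* d = div X, i.e. L_X Om = d Om; d is unique when Om is a volume form. *)
Definition is_divergence (R : realType) (M : manifold R 3)
    (Om : M -> 'rV[R]_3 -> 'rV[R]_3 -> 'rV[R]_3 -> R)
    (X : M -> 'rV[R]_3) (d : M -> R) : Prop :=
  forall p v w z, lie_derivative3 X Om p v w z = d p * Om p v w z.

Definition divergence_free (R : realType) (M : manifold R 3)
    (Om : M -> 'rV[R]_3 -> 'rV[R]_3 -> 'rV[R]_3 -> R)
    (X : M -> 'rV[R]_3) : Prop :=
  is_divergence Om X (fun=> 0).

(* Main.v *)
From Pilot Require Import Defs.
From HB Require Import structures.
From mathcomp Require Import all_boot all_order all_algebra.
From mathcomp Require Import all_classical all_reals all_analysis.
From mathcomp Require Import ring lra.

Set Implicit Arguments.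
Unset Strict Implicit.
Unset Printing Implicit Defensive.
Import Order.TTheory GRing.Theory Num.Theory.
Import numFieldNormedType.Exports.
Local Open Scope classical_set_scope.
Local Open Scope ring_scope.
(* [coord] and other names are shadowed by the preceding imports. *)
Import Pilot.Defs.

(* The normal field is n = grad F / |grad F|^2, which is characterized by
   dF(n) = 1 and orthogonality to ker dF; hence it is chart independent and
   smooth. If v in ker dF and v <> 0, then n, v are independent, so
   Om(n, v, z) <> 0 for some z, and z may be replaced by z - dF(z) n, which is
   in ker dF and therefore, by the implicit function theorem, tangent to Sigma.
   For invariance, let J1, J2 be the images of two tangent vectors under the
   flow. In a chart J_i' = D_{J_i} X, whereas dF(L_X n) = X(dF(n)) - n(dF(X)) = 0,
   so that Om(L_X n, J1, J2) = 0, these being three vectors in the plane ker dF.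
   Hence the derivative of Om(n, J1, J2) along the flow is
   (L_X Om)(n, J1, J2) = 0. *)

(** * Calculus of C^k maps *)

(** The normalization dF(n) = 1, rather than |n| = 1, is what makes dF(n) constant along orbits; a
    unit normal would bring in the variation of |grad F| along X. Although [omega_n] lives on Sigma,
    n is built on a neighborhood of each point of Sigma, because the bracket identity differentiates
    dF(n) = 1 and dF(X) = 0 in ambient coordinates. The flow is given as a smooth family of maps of
    Sigma, and tangent vectors of Sigma are velocities of curves c. The images of c'(0) are
    therefore read off the two-parameter map (t, s) -> phi t (c s): its t-derivative is X, its
    s-derivative at s = 0 is the transported vector, and the symmetry of mixed partials yields the
    variational equation. Since [lie_derivative3] is written in the preferred chart at the point
    itself, the derivative in time is computed at each t0 in the chart at phi t0 p; its vanishing at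
    every t0 makes the transported area constant. *)

Section Ck.
Context {R : realType}.
Implicit Types V W : normedModType R.

Lemma near_eq_differentiable V W (f g : V -> W) x :
  {near x, f =1 g} -> differentiable f x -> differentiable g x.
Proof.
move=> fg df; have fgx := nbhs_singleton fg.
have E : g \o shift x = cst (g x) + 'd f x +o_ 0 id.
  apply/eqaddoP => e e0.
  have [_ /eqaddoP/(_ e e0)] := (diff_locallyP x f).1 df.
  move: fg; rewrite (near_shift 0) => fg.
  apply: filterS2 fg => y /=; rewrite subr0 => fgy.
  by rewrite !fctE /= -fgy -fgx.
have dg : 'd g x = 'd f x :> (V -> W).
  by apply: diff_unique => //; exact: diff_continuous.
by apply/diff_locallyP; rewrite dg; split=> //; exact: diff_continuous.
Qed.

(** All derivatives in [Ck_on] are taken in the ambient space, so the condition is pointwise and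
    makes sense on a singleton. This lets local statements be proved at one point. *)
Lemma Ck_onP V W k (U : set V) (f : V -> W) :
  (forall x, U x -> Ck_on k [set x] f) -> Ck_on k U f.
Proof.
elim: k f => [|k IH] f /= H; first by move=> x Ux; exact: H Ux x erefl.
split=> [x Ux|v]; first exact: (H x Ux).1.
by apply: IH => x Ux; exact: (H x Ux).2.
Qed.

Lemma Ck_on_sub V W k (U U' : set V) (f : V -> W) :
  U' `<=` U -> Ck_on k U f -> Ck_on k U' f.
Proof.
move=> UU; elim: k f => [|k IH] f /=; first by move=> H x /UU; exact: H.
by move=> [df H]; split=> [x /UU/df //|v]; exact/IH.
Qed.

Lemma Ck_onW V W k (U : set V) (f : V -> W) : Ck_on k.+1 U f -> Ck_on k U f.
Proof.
elim: k f => [f [df _] x /df /differentiable_continuous //|k IH f [df H]].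
by split=> // v; exact: IH.
Qed.

Lemma Ck_on_leq V W j k (U : set V) (f : V -> W) : (j <= k)%N ->
  Ck_on k U f -> Ck_on j U f.
Proof.
move=> /subnK <-; elim: (k - j)%N => [//|i IH] /Ck_onW; exact: IH.
Qed.

(** Functions equal near x are equal near every point close to x, so their directional derivatives
    are again equal near x and the induction goes through. *)
Lemma Ck_on_near V W k x (f g : V -> W) :
  (\forall y \near x, f y = g y) -> Ck_on k [set x] f -> Ck_on k [set x] g.
Proof.
elim: k f g => [|k IH] f g /= fg.
  move=> H _ ->; have := H x erefl; rewrite /prop_for /= /continuous_at.
  rewrite -(nbhs_singleton fg) => /(cvg_trans _); apply.
  by apply: near_eq_cvg; exact: filterS fg.
move=> [df H]; split=> [_ ->|v].
  by apply: near_eq_differentiable (df _ erefl).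
apply: IH (H v).
by apply: filterS (nbhs_interior fg) => y fgy; exact: near_eq_derive.
Qed.

Lemma Ck_on_ext V W k (U : set V) (f g : V -> W) : open U ->
  (forall x, U x -> f x = g x) -> Ck_on k U f -> Ck_on k U g.
Proof.
move=> oU fg Hf; apply: Ck_onP => x Ux.
have : Ck_on k [set x] f by apply: Ck_on_sub Hf => _ ->.
apply: Ck_on_near; near=> y; apply: fg; near: y.
exact: open_nbhs_nbhs.
Unshelve. all: by end_near. Qed.

Lemma Ck_on_cst V W k (U : set V) (a : W) : Ck_on k U (cst a).
Proof.
elim: k a => [|k IH] a /=; first by move=> x _; exact: cvg_cst.
split=> [x _|v]; first exact: differentiable_cst.
by have -> : 'D_v (cst a : V -> W) = cst 0; last exact: IH;
  apply/funext => x; rewrite derive_cst.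
Qed.

Lemma Ck_on_lin V W k (U : set V) (l : {linear V -> W}) :
  continuous l -> Ck_on k U l.
Proof.
move=> cl; case: k => [|k] /=; first by move=> x _; exact: cl.
split=> [x _|v]; first exact: linear_differentiable.
have -> : 'D_v l = cst (l v); last exact: Ck_on_cst.
apply/funext => x; rewrite deriveE ?diff_lin//; exact: linear_differentiable.
Qed.

Lemma Ck_onD V W k (U : set V) (f g : V -> W) : open U ->
  Ck_on k U f -> Ck_on k U g -> Ck_on k U (f \+ g).
Proof.
move=> oU; elim: k f g => [|k IH] f g /=.
  by move=> cf cg x Ux; apply: cvgD; [exact: cf|exact: cg].
move=> [df Hf] [dg Hg]; split=> [x Ux|v].
  by apply: differentiableD; [exact: df|exact: dg].
apply: Ck_on_ext (IH _ _ (Hf v) (Hg v)) => // x Ux /=.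
by rewrite deriveD//; apply: diff_derivable; [exact: df|exact: dg].
Qed.

Lemma Ck_onM V k (U : set V) (f g : V -> R) : open U ->
  Ck_on k U f -> Ck_on k U g -> Ck_on k U (f \* g).
Proof.
move=> oU; elim: k f g => [|k IH] f g /=.
  by move=> cf cg x Ux; apply: cvgM; [exact: cf|exact: cg].
move=> [df Hf] [dg Hg]; split=> [x Ux|v].
  by apply: differentiableM; [exact: df|exact: dg].
have Hf' : Ck_on k U f by apply: Ck_onW.
have Hg' : Ck_on k U g by apply: Ck_onW.
apply: Ck_on_ext (Ck_onD oU (IH _ _ Hf' (Hg v)) (IH _ _ (Hf v) Hg')) => // x Ux /=.
rewrite deriveM; first by rewrite /GRing.scale/= (mulrC (g x)).
  exact/diff_derivable/df.
exact/diff_derivable/dg.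
Qed.

(** The derivative of 1/f is -(1/f)^2 times that of f, which involves 1/f only at the previous
    order. *)
Lemma Ck_onV V k (U : set V) (f : V -> R) : open U ->
  (forall x, U x -> f x != 0) -> Ck_on k U f -> Ck_on k U (fun x => (f x)^-1).
Proof.
move=> oU f0; elim: k => [|k IH] /=.
  by move=> cf x Ux; apply: cvgV; [exact: f0|exact: cf].
move=> [df Hf]; split=> [x Ux|v].
  by apply: differentiableV; [exact: df|exact: f0].
have Hi : Ck_on k U (fun x => (f x)^-1) by apply: IH; exact: Ck_onW.
have H := Ck_onM oU (Ck_on_cst k U (-1 : R)) (Ck_onM oU (Ck_onM oU Hi Hi) (Hf v)).
apply: Ck_on_ext H => // x Ux /=.
rewrite deriveV ?f0//; last exact/diff_derivable/df.
by rewrite /GRing.scale /= mulN1r mulNr expr2 invfM.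
Qed.

Lemma Ck_on_sum V W k (U : set V) (I : Type) (r : seq I) (P : pred I)
    (f : I -> V -> W) : open U ->
  (forall i, P i -> Ck_on k U (f i)) ->
  Ck_on k U (fun x => \sum_(i <- r | P i) f i x).
Proof.
move=> oU H; elim: r => [|i r IH].
  by apply: Ck_on_ext (Ck_on_cst k U (0 : W)) => // x _; rewrite big_nil.
have [Pi|Pi] := boolP (P i).
  apply: Ck_on_ext (Ck_onD oU (H i Pi) IH) => // x _.
  by rewrite big_cons Pi.
by apply: Ck_on_ext IH => // x _; rewrite big_cons (negbTE Pi).
Qed.

Lemma Ck_on_prod V k (U : set V) (I : Type) (r : seq I) (P : pred I)
    (f : I -> V -> R) : open U ->
  (forall i, P i -> Ck_on k U (f i)) ->
  Ck_on k U (fun x => \prod_(i <- r | P i) f i x).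
Proof.
move=> oU H; elim: r => [|i r IH].
  by apply: Ck_on_ext (Ck_on_cst k U (1 : R)) => // x _; rewrite big_nil.
have [Pi|Pi] := boolP (P i).
  apply: Ck_on_ext (Ck_onM oU (H i Pi) IH) => // x _.
  by rewrite big_cons Pi.
by apply: Ck_on_ext IH => // x _; rewrite big_cons (negbTE Pi).
Qed.

End Ck.

(** * Compositions and the mean value theorem along lines *)

Section CkComposition.
Context {R : realType}.
Implicit Types V W E : normedModType R.

Lemma derive_scalel V W (f : V -> R) (w : W) x v : differentiable f x ->
  'D_v (fun y => f y *: w) x = 'D_v f x *: w.
Proof.
move=> df; rewrite !deriveE//; last exact: differentiableZl.
by rewrite diffZl.
Qed.

Lemma Ck_on_scalel V W k (U : set V) (f : V -> R) (w : W) : open U ->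
  Ck_on k U f -> Ck_on k U (fun x => f x *: w).
Proof.
move=> oU; elim: k f => [|k IH] f /=.
  by move=> cf x Ux; apply: cvgZr_tmp; exact: cf.
move=> [df Hf]; split=> [x Ux|v]; first exact/differentiableZl/df.
apply: Ck_on_ext (IH _ (Hf v)) => // x Ux /=.
by rewrite derive_scalel//; exact: df.
Qed.

Lemma Ck_on_rV V n k (U : set V) (f : V -> 'rV[R]_n) : open U ->
  (forall i, Ck_on k U (fun x => f x 0 i)) -> Ck_on k U f.
Proof.
move=> oU H; apply: Ck_on_ext (Ck_on_sum (index_enum 'I_n) (P := xpredT)
  (f := fun i x => f x 0 i *: delta_mx 0 i : 'rV[R]_n) oU _) => //.
  by move=> x _; rewrite [RHS]row_sum_delta.
by move=> i _; exact: Ck_on_scalel.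
Qed.

Lemma differentiable_coord_comp V n (f : V -> 'rV[R]_n) x i :
  differentiable f x -> differentiable (fun y => f y 0 i) x.
Proof.
move=> df; apply: (differentiable_comp (g := fun N : 'rV[R]_n => N 0 i)) => //.
exact: differentiable_coord.
Qed.

Lemma derive_coord V n (f : V -> 'rV[R]_n) x v i : derivable f x v ->
  'D_v (fun y => f y 0 i) x = 'D_v f x 0 i.
Proof. by move=> df; rewrite derive_mx// mxE. Qed.

Lemma Ck_on_coord V n k (U : set V) (f : V -> 'rV[R]_n) i : open U ->
  Ck_on k U f -> Ck_on k U (fun x => f x 0 i).
Proof.
move=> oU; elim: k f => [|k IH] f /=.
  move=> cf x Ux; apply: (continuous_comp (g := fun N : 'rV[R]_n => N 0 i)).
    exact: cf.
  exact: coord_continuous.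
move=> [df Hf]; split=> [x Ux|v]; first exact/differentiable_coord_comp/df.
apply: Ck_on_ext (IH _ (Hf v)) => // x Ux /=.
by rewrite derive_coord//; exact/diff_derivable/df.
Qed.

(* Composition through a map given by its components in a finite family of
   vectors, which covers maps into 'rV_n as well as into products. *)
Lemma Ck_on_comp_span V E m k (D : set V) (U : set E) (l : 'I_m -> V -> R)
    (e : 'I_m -> E) (g : E -> R) : open D ->
  (forall x, D x -> U (\sum_i l i x *: e i)) ->
  (forall i, Ck_on k D (l i)) -> Ck_on k U g ->
  Ck_on k D (fun x => g (\sum_i l i x *: e i)).
Proof.
move=> oD DU; elim: k g => [|k IH] g Hl Hg.
  move=> x Dx; apply: (continuous_comp (f := fun x => \sum_i l i x *: e i)).
    by apply: (@Ck_on_sum _ _ _ 0 D) => // i _; exact/Ck_on_scalel/Hl.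
  exact/Hg/DU.
have Hl' i : Ck_on k D (l i) by exact: Ck_onW.
have df x : D x -> differentiable (fun x => \sum_i l i x *: e i) x.
  move=> Dx; pose f := fun x => \sum_i l i x *: e i.
  have : Ck_on 1 D f.
    apply: Ck_on_sum => // i _; apply: Ck_on_scalel => //.
    exact: Ck_on_leq (Hl i).
  by case=> + _; exact.
have [dg Hdg] := Hg; split=> [x Dx|v].
  by apply: (differentiable_comp (f := fun x => \sum_i l i x *: e i));
    [exact: df|exact/dg/DU].
(* By the chain rule the derivative is a sum of products in which g is replaced by its partial
   derivative along [e i], with the same inner map; the induction hypothesis, general in g, applies
   to it. *)
have H : Ck_on k D (fun x => \sum_i 'D_v (l i) x *
    'D_(e i) g (\sum_i l i x *: e i)).
  apply: Ck_on_sum => // i _; apply: Ck_onM => //; first by case: (Hl i) => _; exact.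
  exact: (IH _ Hl' (Hdg (e i))).
apply: Ck_on_ext H => // x Dx.
rewrite deriveE; last first.
  by apply: (differentiable_comp (f := fun x => \sum_i l i x *: e i));
    [exact: df|exact/dg/DU].
rewrite (diff_comp (f := fun x => \sum_i l i x *: e i) (g := g) (df _ Dx)
  (dg _ (DU _ Dx))) /=.
rewrite -(deriveE v (df _ Dx)).
have -> : 'D_v (fun x => \sum_i l i x *: e i) x = \sum_i 'D_v (l i) x *: e i.
  have -> : (fun x => \sum_i l i x *: e i) = \sum_i (fun x => l i x *: e i).
    by apply/funext => y; rewrite fct_sumE.
  rewrite derive_sum => [|i]; last first.
    by apply/diff_derivable/differentiableZl; case: (Hl i) => + _; exact.
  by apply: eq_bigr => i _; rewrite derive_scalel//; case: (Hl i) => + _; exact.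
rewrite linear_sum; apply: eq_bigr => i _.
by rewrite linearZ/= (deriveE (e i) (dg _ (DU _ Dx))).
Qed.

Lemma Ck_on_comp V n k (D : set V) (U : set 'rV[R]_n) (f : V -> 'rV[R]_n)
    (g : 'rV[R]_n -> R) : open D -> (forall x, D x -> U (f x)) ->
  Ck_on k D f -> Ck_on k U g -> Ck_on k D (g \o f).
Proof.
move=> oD DU Hf Hg.
have E x : f x = \sum_i f x 0 i *: delta_mx 0 i by exact: row_sum_delta.
have -> : g \o f = fun x => g (\sum_i f x 0 i *: delta_mx 0 i).
  by apply/funext => x /=; rewrite -E.
apply: Ck_on_comp_span Hg => // [x Dx|i]; first by rewrite -E; exact: DU.
exact: Ck_on_coord.
Qed.

Lemma Ck_on_comp_rV V n m k (D : set V) (U : set 'rV[R]_n) (f : V -> 'rV[R]_n)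
    (g : 'rV[R]_n -> 'rV[R]_m) : open D -> open U -> (forall x, D x -> U (f x)) ->
  Ck_on k D f -> Ck_on k U g -> Ck_on k D (g \o f).
Proof.
move=> oD oU DU Hf Hg; apply: Ck_on_rV => // i.
exact: (Ck_on_comp oD DU Hf (Ck_on_coord i oU Hg)).
Qed.

Lemma derive_line V W (f : V -> W) (x v : V) (t : R) :
  'D_(1 : R) (fun t : R => f (x + t *: v)) t = 'D_v f (x + t *: v).
Proof.
rewrite /derive; set a := (X in lim (X @ _) = _); set b := (X in _ = lim (X @ _)).
suff -> : a = b by []; apply/funext => h; rewrite /a /b /=.
by rewrite scalerDl addrCA [h *: (1 : R)]mulr1.
Qed.

Lemma derivable_line V W (f : V -> W) (x v : V) (t : R) :
  derivable f (x + t *: v) v -> derivable (fun t : R => f (x + t *: v)) t 1.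
Proof.
rewrite /derivable; set a := (X in cvg (X @ _)); set b := (X in _ -> cvg (X @ _)).
suff -> : a = b by [].
by apply/funext => h; rewrite /a/b/= scalerDl addrCA [h *: (1 : R)]mulr1.
Qed.

Lemma MVT_line V (f : V -> R) (x v : V) (h : R) : 0 <= h ->
  (forall t, 0 <= t <= h -> differentiable f (x + t *: v)) ->
  exists2 t, 0 <= t <= h & f (x + h *: v) - f x = h * 'D_v f (x + t *: v).
Proof.
move=> h0 df.
have [|t|t tI E] := @MVT_segment R (fun t : R => f (x + t *: v))
   (fun t : R => 'D_v f (x + t *: v)) 0 h h0.
- move=> t; rewrite in_itv /= => /andP[t0 th]; apply: DeriveDef.
    by apply/derivable_line/diff_derivable/df; rewrite !ltW.
  exact: derive_line.
- apply: (@continuous_in_subspaceT _ _ `[0, h] (fun t : R => f (x + t *: v))) => s.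
  rewrite inE /= in_itv /= => sI.
  apply: (continuous_comp (f := fun t : R => x + t *: v)).
    by apply: cvgD; [exact: cvg_cst|apply: cvgZr_tmp; exact: cvg_id].
  exact/differentiable_continuous/df.
- exists t; first by move: tI; rewrite in_itv.
  by move: E; rewrite subr0 scale0r addr0 mulrC.
Qed.

End CkComposition.

(** * Symmetry of second derivatives *)

Section SchwarzLevelCurve.
Context {R : realType}.
Implicit Types V : normedModType R.

Lemma nbhs_square V (A : set V) (x v w : V) : nbhs x A ->
  exists2 h : R, 0 < h &
    forall s t, `|s| <= h -> `|t| <= h -> A (x + s *: v + t *: w).
Proof.
move=> /nbhs_ballP[d /= d0 dA].
(* The summand 1 keeps m positive when v = w = 0. For |s|, |t| <= d/2/m the displacement is at most
   d/2 times (|v| + |w|)/m < 1. *)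
pose m := `|v| + `|w| + 1.
have m0 : 0 < m by rewrite /m ltr_wpDl// addr_ge0.
exists (d / 2 / m) => [|s t sh th]; first by rewrite !divr_gt0.
apply: dA; rewrite -ball_normE /= -addrA opprD addrA subrr add0r normrN.
apply: le_lt_trans (ler_normD _ _) _; rewrite !normrZ.
have H1 := ler_wpM2r (normr_ge0 v) sh; have H2 := ler_wpM2r (normr_ge0 w) th.
apply: le_lt_trans (lerD H1 H2) _; rewrite -mulrDr.
have -> : d / 2 / m * (`|v| + `|w|) = d / 2 * ((`|v| + `|w|) / m).
  by rewrite -!mulrA (mulrC m^-1).
have : (`|v| + `|w|) / m < 1 by rewrite ltr_pdivrMr// mul1r /m ltrDl.
have : 0 <= (`|v| + `|w|) / m by rewrite divr_ge0 ?addr_ge0// ltW.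
by move: (_ / m) => y y0 y1; nra.
Qed.

Lemma derive_translate V (f : V -> R) (a x v : V) :
  'D_v (fun y => f (y + a)) x = 'D_v f (x + a).
Proof.
rewrite /derive; set p := (X in lim (X @ _) = _); set q := (X in _ = lim (X @ _)).
by suff -> : p = q by []; apply/funext => h; rewrite /p /q /= addrA.
Qed.

Lemma differentiable_translate V (f : V -> R) (a x : V) :
  differentiable f (x + a) -> differentiable (fun y => f (y + a)) x.
Proof.
move=> df; apply: (differentiable_comp (f := fun y => y + a) (g := f)).
  by apply: differentiableD; [exact: ex_diff|exact: differentiable_cst].
exact: df.
Qed.

(** The mean value theorem is applied twice: along v to the difference of f and its translate by h
    w, then along w to the derivative of f in the direction v. *)
Lemma second_difference V (f : V -> R) (U : set V) (x v w : V) (h : R) :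
  0 <= h -> Ck_on 2 U f ->
  (forall s t, `|s| <= h -> `|t| <= h -> U (x + s *: v + t *: w)) ->
  exists s t, [/\ `|s| <= h, `|t| <= h &
    (f (x + h *: v + h *: w) - f (x + h *: v)) - (f (x + h *: w) - f x) =
    h ^+ 2 * 'D_w ('D_v f) (x + s *: v + t *: w)].
Proof.
move=> h0 [df Hf] HU.
have N0 : `|0 : R| <= h by rewrite normr0.
have Nh : `|h| <= h by rewrite ger0_norm.
have It t : 0 <= t <= h -> `|t| <= h by move=> /andP[? ?]; rewrite ger0_norm.
have HU0 s : `|s| <= h -> U (x + s *: v).
  by move=> sh; have := HU s 0 sh N0; rewrite scale0r addr0.
have dfh s t : `|s| <= h -> `|t| <= h -> differentiable f (x + s *: v + t *: w).
  by move=> sh th; exact/df/HU.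
have dfh0 s : `|s| <= h -> differentiable f (x + s *: v).
  by move=> sh; exact/df/HU0.
pose G y := f (y + h *: w) - f y.
have dG t : 0 <= t <= h -> differentiable G (x + t *: v).
  move=> /It th; apply: differentiableB; last exact: dfh0.
  exact/differentiable_translate/dfh.
have [s /It sh] := MVT_line h0 dG; rewrite /G.
rewrite (deriveB (f := fun y => f (y + h *: w))); last 2 first.
- exact/diff_derivable/differentiable_translate/dfh.
- exact/diff_derivable/dfh0.
rewrite derive_translate => ->.
have [|t /It th ->] := @MVT_line R V ('D_v f) (x + s *: v) w h h0.
  by move=> t /It th; have [+ _] := Hf v; apply; exact: HU.
by exists s, t; split => //; rewrite expr2 mulrA.
Qed.

(** The second difference is symmetric in v and w. Hence the two mixed derivatives take a common
    value at two points of an arbitrarily small parallelogram, and continuity at x makes them agree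
    there. *)
Lemma derive_swap V (f : V -> R) (U : set V) (x v w : V) :
  open U -> U x -> Ck_on 2 U f -> 'D_v ('D_w f) x = 'D_w ('D_v f) x.
Proof.
move=> oU Ux Hf.
have [_ Hf1] := Hf.
have cvw : {for x, continuous ('D_v ('D_w f))} by exact: ((Hf1 w).2 v x Ux).
have cwv : {for x, continuous ('D_w ('D_v f))} by exact: ((Hf1 v).2 w x Ux).
apply/eqP; rewrite -subr_eq0 -normr_le0; apply/ler_addgt0Pr => e e0; rewrite add0r.
have e2 : 0 < e / 2 by rewrite divr_gt0.
move/cvgrPdist_lt : cvw => /(_ _ e2) nvw.
move/cvgrPdist_lt : cwv => /(_ _ e2) nwv.
have nU : nbhs x U by exact: open_nbhs_nbhs.
have [h h0 hA] := nbhs_square v w (filterI nU (filterI nvw nwv)).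
have HU s t : `|s| <= h -> `|t| <= h -> U (x + s *: v + t *: w).
  by move=> sh th; case: (hA s t sh th).
have HU' s t : `|s| <= h -> `|t| <= h -> U (x + s *: w + t *: v).
  by move=> sh th; rewrite addrAC; exact: HU.
have [s [t [sh th E]]] := second_difference (ltW h0) Hf HU.
have [s' [t' [sh' th' E']]] := second_difference (ltW h0) Hf HU'.
have EE : 'D_w ('D_v f) (x + s *: v + t *: w) =
          'D_v ('D_w f) (x + s' *: w + t' *: v).
  have h2 : h ^+ 2 != 0 by rewrite expf_neq0// gt_eqF.
  apply: (mulfI h2); rewrite -E -E' (addrAC x (h *: w)); ring.
have [_ [_ A1]] := hA s t sh th.
have [_ [A2 _]] := hA t' s' th' sh'.
rewrite (addrAC x) -EE in A2.
move: A1 A2; rewrite /=; move: ('D_w ('D_v f) (x + s *: v + t *: w)) => c.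
move: ('D_w ('D_v f) x) ('D_v ('D_w f) x) => a b A1 A2.
have -> : b - a = (b - c) - (a - c) by ring.
rewrite [e]splitr; apply: le_trans (ler_normB _ _) _.
by apply: lerD; exact: ltW.
Qed.

End SchwarzLevelCurve.

(** * The implicit function theorem for curves in a level set *)

Section LevelCurve.
Context {R : realType} {n : nat}.
Variables (f : 'rV[R]_n -> R) (U : set 'rV[R]_n) (u0 w e : 'rV[R]_n).
Hypotheses (oU : open U) (smf : smooth_on U f) (Uu0 : U u0).
Hypothesis fe : 'D_e f u0 = 1.

Let pt (t s : R) := u0 + t *: w + s *: e.

Let ptD t s s' : pt t s' = pt t s + (s' - s) *: e.
Proof. by rewrite /pt -[RHS]addrA -scalerDl subrKC. Qed.

Let dif x : U x -> differentiable f x.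
Proof. by case: (smf 1) => + _; exact. Qed.

Let df_cont v x : U x -> {for x, continuous ('D_v f)}.
Proof. by case: (smf 1) => _ /(_ v); exact. Qed.

Lemma level_curve_box : exists2 h : R, 0 < h &
  forall t s, `|t| <= h -> `|s| <= h -> U (pt t s) /\ 1 / 2 < 'D_e f (pt t s).
Proof.
have : nbhs u0 (U `&` [set x | 1 / 2 < 'D_e f x]).
  apply: filterI; first exact: open_nbhs_nbhs.
  have := df_cont (v := e) Uu0; move/cvgrPdist_lt => /(_ (1 / 2)) H.
  apply: filterS (H _); last by rewrite divr_gt0.
  by move=> x /=; rewrite fe ltr_norml => /andP[_]; lra.
by move=> /(nbhs_square w e)[h h0 H]; exists h.
Qed.

(** The intermediate parameter r is located within |s' - s| of s, so that it tends to s when s'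
    does; this gives the limit of difference quotients in [level_curve]. *)
Lemma level_mvt (h t s s' : R) :
  (forall t s : R, `|t| <= h -> `|s| <= h ->
     U (pt t s) /\ 1 / 2 < 'D_e f (pt t s)) ->
  `|t| <= h -> `|s| <= h -> `|s'| <= h ->
  exists r, [/\ `|r - s| <= `|s' - s|, `|r| <= h &
    f (pt t s') - f (pt t s) = (s' - s) * 'D_e f (pt t r)].
Proof.
move=> H th sh sh'.
have Hr (o : R) : 0 <= o <= 1 -> `|s + o * (s' - s)| <= h.
  move: sh sh'; rewrite !ler_norml => /andP[? ?] /andP[? ?] /andP[? ?].
  by apply/andP; split; nra.
have E (o : R) : pt t s + o *: ((s' - s) *: e) = pt t (s + o * (s' - s)).
  by rewrite (ptD t s (s + o * (s' - s))) scalerA; congr (_ + _ *: _); ring.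
have [|o o01] := @MVT_line R _ f (pt t s) ((s' - s) *: e) 1 ler01.
  by move=> o ol; rewrite E; apply: dif; case: (H t _ th (Hr _ ol)).
rewrite scale1r mul1r -ptD E => ->; exists (s + o * (s' - s)); split.
- rewrite addrC addKr normrM ler_piMl//; move/andP: o01 => [? ?].
  by rewrite ger0_norm.
- exact: Hr.
- have [Up _] := H t _ th (Hr _ o01).
  by rewrite !deriveE ?linearZ//; exact: dif.
Qed.

(** In the box f increases along e at rate more than 1/2, so each nearby t has one s(t) on the
    level. Its slope is minus the ratio of the derivatives of f along w and e; it vanishes at 0, so
    the curve leaves u0 with velocity w. *)
Lemma level_curve : 'D_w f u0 = 0 ->
  exists (d : R) (s : R -> R), [/\ 0 < d, s 0 = 0, smooth_on (ball (0 : R) d) s,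
    is_derive (0 : R) 1 s 0 &
    forall t, ball (0 : R) d t -> U (pt t (s t)) /\ f (pt t (s t)) = f u0].
Proof.
move=> fw; have [h h0 H] := level_curve_box.
have pt00 : pt 0 0 = u0 by rewrite /pt !scale0r !addr0.
have N0 : `|0 : R| <= h by rewrite normr0 ltW.
have Nh : `|h| <= h by rewrite ger0_norm// ltW.
have NNh : `|- h| <= h by rewrite normrN.
have cpt (s t : R) : {for t, continuous (fun t => pt t s)}.
  by apply: cvgD; [apply: cvgD; [exact: cvg_cst|apply: cvgZr_tmp; exact: cvg_id]|exact: cvg_cst].
have cpts (s t : R) : {for s, continuous (fun s => pt t s)}.
  by apply: cvgD; [exact: cvg_cst|apply: cvgZr_tmp; exact: cvg_id].
have cf s t : `|t| <= h -> `|s| <= h -> {for t, continuous (fun t => f (pt t s))}.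
  move=> th sh; apply: (continuous_comp (f := fun t => pt t s)) => //.
  by apply/differentiable_continuous/dif; case: (H _ _ th sh).
have up : f u0 < f (pt 0 h).
  have [r [_ rh]] := level_mvt H N0 N0 Nh; rewrite pt00 subr0.
  by have [_] := H _ _ N0 rh; move: ('D_e f _) => D DD E; nra.
have dn : f (pt 0 (- h)) < f u0.
  have [r [_ rh]] := level_mvt H N0 N0 NNh; rewrite pt00 subr0.
  by have [_] := H _ _ N0 rh; move: ('D_e f _) => D DD E; nra.
have nup : \forall t \near (0 : R), f u0 < f (pt t h).
  by apply: (cvgr_gt _ (cf h 0 N0 Nh)).
have ndn : \forall t \near (0 : R), f (pt t (- h)) < f u0.
  by apply: (cvgr_lt _ (cf (- h) 0 N0 NNh)).
have [d /= d0 hd] : exists2 d : R, 0 < d & ball (0 : R) d `<=`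
    [set t | `|t| <= h /\ (f (pt t (- h)) < f u0 /\ f u0 < f (pt t h))].
  apply/nbhs_ballP; apply: filterI; last exact: filterI.
  apply/nbhs_ballP; exists h => // t; rewrite -ball_normE /= sub0r normrN.
  exact: ltW.
(* For t in the ball, f - f(u0) changes sign between s = -h and s = h, and the intermediate value
   theorem applies. Outside the ball s is unconstrained. *)
have /choice[s Hs] : forall t, exists s, ball (0 : R) d t ->
    `|s| <= h /\ f (pt t s) = f u0.
  move=> t; have [bt|nb] := pselect (ball (0 : R) d t); last by exists 0.
  have [th [lo hi]] := hd t bt.
  have hN : - h <= h by lra.
  have [||s sI fs] := @IVT _ (fun s => f (pt t s)) _ _ (f u0) hN.
  - apply: (@continuous_in_subspaceT _ _ `[- h, h] (fun s => f (pt t s))) => s.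
    rewrite inE /= in_itv /= => sI.
    have sh : `|s| <= h by rewrite ler_norml.
    apply: (continuous_comp (f := fun s => pt t s)) => //.
    by apply/differentiable_continuous/dif; case: (H _ _ th sh).
  - have lh := ltW (lt_trans lo hi).
    by rewrite (min_idPl lh) (max_idPr lh) !ltW.
  - by exists s => _; split => //; move: sI; rewrite in_itv /= ler_norml.
have sb t : ball (0 : R) d t -> `|s t| <= h by move=> /Hs[].
have sf t : ball (0 : R) d t -> f (pt t (s t)) = f u0 by move=> /Hs[].
have tb t : ball (0 : R) d t -> `|t| <= h by move=> /hd[].
have b0 : ball (0 : R) d 0 by exact: ballxx.
have bU t : ball (0 : R) d t -> U (pt t (s t)).
  by move=> bt; case: (H _ _ (tb _ bt) (sb _ bt)).
(* The factor 2 is the inverse of the lower bound 1/2. This estimate yields both s(0) = 0 and the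
   continuity of s. *)
have inj t r r' : `|t| <= h -> `|r| <= h -> `|r'| <= h ->
    `|r' - r| <= 2 * `|f (pt t r') - f (pt t r)|.
  move=> th rh rh'; have [q [_ qh ->]] := level_mvt H th rh rh'.
  have [_ D] := H _ _ th qh; rewrite normrM mulrCA ler_peMr//.
  by rewrite gtr0_norm; nra.
have s0 : s 0 = 0.
  have := inj 0 0 (s 0) N0 N0 (sb _ b0).
  by rewrite pt00 (sf _ b0) subrr normr0 mulr0 subr0 normr_le0 => /eqP.
have ob t : ball (0 : R) d t -> \forall t' \near t, ball (0 : R) d t'.
  by move=> bt; apply: open_nbhs_nbhs; split => //; exact: ball_open.
have cs t : ball (0 : R) d t -> {for t, continuous s}.
  move=> bt; apply/cvgrPdist_lt => eps e0.
  have /cvgrPdist_lt := cf (s t) t (tb _ bt) (sb _ bt).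
  have e2 : 0 < eps / 2 by rewrite divr_gt0.
  move=> /(_ _ e2) N; apply: filterS2 (ob _ bt) N => t' bt'.
  have := inj t' (s t') (s t) (tb _ bt') (sb _ bt') (sb _ bt).
  rewrite (sf _ bt') (sf _ bt) (distrC (f u0)) => le1 lt1.
  by apply: le_lt_trans le1 _; lra.
pose ds t := - 'D_w f (pt t (s t)) / 'D_e f (pt t (s t)).
have Dpos t : ball (0 : R) d t -> 'D_e f (pt t (s t)) != 0.
  move=> bt; have [_ D] := H _ _ (tb _ bt) (sb _ bt).
  by apply/eqP => E; rewrite E in D; lra.
have isd t : ball (0 : R) d t -> is_derive t 1 s (ds t).
  move=> bt.
  have /choice[r Hr] : forall t', exists r, ball (0 : R) d t' ->
      [/\ `|r - s t| <= `|s t' - s t|, `|r| <= h &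
      f u0 - f (pt t' (s t)) = (s t' - s t) * 'D_e f (pt t' r)].
    move=> t'; have [bt'|nb] := pselect (ball (0 : R) d t'); last by exists 0.
    have [r Hr] := level_mvt H (tb _ bt') (sb _ bt) (sb _ bt').
    by exists r => _; rewrite -(sf _ bt').
  (* Since f has the same value at both ends of the curve, the difference quotient of s equals that
     of f in t at frozen s(t), up to sign, divided by the e-derivative at the intermediate point
     r. *)
  pose q k := - (k^-1 *: (f (pt (k + t) (s t)) - f (pt t (s t)))) /
              'D_e f (pt (k + t) (r (k + t))).
  have nt : \forall k \near (0 : R)^', ball (0 : R) d (k + t).
    apply: cvg_within; have := ob _ bt; rewrite (near_shift 0) => ob'.
    by apply: filterS ob' => k; rewrite /= subr0.
  have qE : \forall k \near (0 : R)^', q k = k^-1 *: (s (k + t) - s t).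
    apply: filterS nt => k bk; rewrite /q.
    have [_ rh E] := Hr _ bk.
    have [_ D] := H _ _ (tb _ bk) rh.
    rewrite (sf _ bt) -scalerN opprB E /GRing.scale /= -mulrA mulfK//.
    by apply/eqP => E0; rewrite E0 in D; lra.
  have rc : r t' @[t' --> t] --> s t.
    apply/cvgrPdist_lt => eps e0.
    have /cvgrPdist_lt/(_ _ e0) N := cs _ bt.
    apply: filterS2 (ob _ bt) N => t' /Hr[le1 _ _]; apply: le_lt_trans.
    by rewrite distrC (distrC (s t)).
  have shc : (k + t) @[k --> (0 : R)^'] --> t.
    apply: cvg_within_filter.
    have : (k + t) @[k --> (0 : R)] --> 0 + t.
      by apply: cvgD; [exact: cvg_id|exact: cvg_cst].
    by rewrite add0r.
  have qc : q k @[k --> (0 : R)^'] --> ds t.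
    apply: cvgM; last first.
      apply: cvgV; first exact: Dpos.
      have c1 : 'D_e f (pt t' (r t')) @[t' --> t] --> 'D_e f (pt t (s t)).
        apply: (@cvg_comp _ _ _ (fun t' => pt t' (r t')) ('D_e f) _ _ _ _
          (df_cont (bU _ bt))).
        apply: cvgD; last exact: cvgZr_tmp.
        by apply: cvgD; [exact: cvg_cst|apply: cvgZr_tmp; exact: cvg_id].
      have c2 := @cvg_comp _ _ _ (fun k : R => k + t) (fun t' => 'D_e f (pt t' (r t'))) _ _ _ shc c1. exact: c2.
    apply: cvgN; have Hd : derivable f (pt t (s t)) w.
      exact/diff_derivable/dif/bU.
    move: Hd; rewrite /derivable => Hd; apply: cvg_trans Hd.
    apply: near_eq_cvg; near=> k => /=.
    by rewrite /pt scalerDl; congr (_ *: (f _ - _)); rewrite !addrA (addrC _ u0).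
  have sq : k^-1 *: ((s \o shift t) (k *: (1 : R)) - s t) @[k --> (0 : R)^'] --> ds t.
    apply: cvg_trans qc; apply: near_eq_cvg; apply: filterS qE => k ->.
    by rewrite /= [_ *: (1 : R)]mulr1.
  apply: DeriveDef; last exact: (@cvg_lim _ (@norm_hausdorff _ _) _ _ _ _ _ sq).
  by apply/cvg_ex; exists (ds t).
have ds0 : ds 0 = 0 by rewrite /ds s0 pt00 fw oppr0 mul0r.
exists d, s; split=> //; last 2 first.
- by have := isd _ b0; rewrite ds0.
- by move=> t bt; split; [exact: bU|exact: sf].
have oB : open (ball (0 : R) d) by exact: ball_open.
(* Bootstrap: if s is C^k then so is the formula [ds] for its derivative, hence s is C^(k+1). *)
elim=> [|k IH] /=; first by move=> t; exact: cs.
split=> [t bt|v].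
  by apply/derivable1_diffP; case: (isd t bt).
have Cc : Ck_on k (ball (0 : R) d) (fun t => pt t (s t)).
  apply: Ck_onD => //; last exact: Ck_on_scalel.
  apply: Ck_onD => //; first exact: Ck_on_cst.
  apply: Ck_on_scalel => //.
  apply: (@Ck_on_lin _ _ _ _ _ (idfun : {linear R -> R})) => x; exact: cvg_id.
have [_ Df] := smf k.+1.
have C1 := Ck_on_comp oB bU Cc (Df w).
have C2 := Ck_onV oB Dpos (Ck_on_comp oB bU Cc (Df e)).
have C3 := Ck_onM oB (Ck_on_cst k _ (- v)) (Ck_onM oB C1 C2).
apply: Ck_on_ext C3 => // t bt /=.
have [dst dsE] := isd t bt.
have df : differentiable s t by apply/derivable1_diffP.
have -> : 'D_v s t = v * ds t.
  by rewrite (deriveE v df) deriv1E// derive1E dsE.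
rewrite /ds; ring.
Unshelve. all: by end_near. Qed.
End LevelCurve.

(** * Alternating 3-forms and normal vectors in coordinates *)

Section LinearAlgebra.
Context {R : realType}.

Lemma scalar0 n (l : 'rV[R]_n -> R) : scalar l -> l 0 = 0.
Proof. by move=> sl; have := sl (-1) 0 0; rewrite scaler0 addr0 mulN1r addNr. Qed.

Lemma scalar_sum n (I : Type) (r : seq I) (l : 'rV[R]_n -> R) (c : I -> R) f :
  scalar l -> l (\sum_(i <- r) c i *: f i) = \sum_(i <- r) c i * l (f i).
Proof.
move=> sl; elim: r => [|i r IH]; last by rewrite !big_cons sl IH.
by rewrite !big_nil scalar0.
Qed.

Definition i30 : 'I_3 := @Ordinal 3 0 isT.
Definition i31 : 'I_3 := @Ordinal 3 1 isT.
Definition i32 : 'I_3 := @Ordinal 3 2 isT.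

Lemma sum_ord3 (V : nmodType) (F : 'I_3 -> V) :
  \sum_i F i = F i30 + F i31 + F i32.
Proof.
rewrite !big_ord_recl big_ord0 addr0 addrA.
by congr (F _ + F _ + F _); apply: val_inj.
Qed.

Lemma ord3P (P : 'I_3 -> Prop) : P i30 -> P i31 -> P i32 -> forall i, P i.
Proof.
move=> P0 P1 P2 [[|[|[|//]]] lt3].
- by rewrite (_ : Ordinal _ = i30)//; exact: val_inj.
- by rewrite (_ : Ordinal _ = i31)//; exact: val_inj.
- by rewrite (_ : Ordinal _ = i32)//; exact: val_inj.
Qed.

(** The determinant with rows a, b, c as an explicit polynomial, so that its identities are decided
    by [ring]. *)
Definition det3 (a b c : 'rV[R]_3) : R :=
  a 0 i30 * (b 0 i31 * c 0 i32 - b 0 i32 * c 0 i31)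
  - a 0 i31 * (b 0 i30 * c 0 i32 - b 0 i32 * c 0 i30)
  + a 0 i32 * (b 0 i30 * c 0 i31 - b 0 i31 * c 0 i30).

Definition alternating3 (om : 'rV[R]_3 -> 'rV[R]_3 -> 'rV[R]_3 -> R) : Prop :=
  (forall v w, [/\ scalar (om v w), scalar (fun z => om v z w)
    & scalar (fun z => om z v w)]) /\
  (forall v w, [/\ om v v w = 0, om v w v = 0 & om w v v = 0]).

Let e (i : 'I_3) : 'rV[R]_3 := delta_mx 0 i.

Definition coef3 (om : 'rV[R]_3 -> 'rV[R]_3 -> 'rV[R]_3 -> R) : R :=
  om (delta_mx 0 i30) (delta_mx 0 i31) (delta_mx 0 i32).

Lemma scalar_expand3 (l : 'rV[R]_3 -> R) : scalar l -> forall a,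
  l a = a 0 i30 * l (e i30) + a 0 i31 * l (e i31) + a 0 i32 * l (e i32).
Proof.
by move=> sl a; rewrite {1}(row_sum_delta a) scalar_sum// sum_ord3.
Qed.

(** Expansion in the basis leaves only the terms with three distinct indices, and antisymmetry
    reduces each of them to [coef3]. *)
Lemma alternating3E om a b c : alternating3 om ->
  om a b c = coef3 om * det3 a b c.
Proof.
move=> [lin alt].
have L1 x y z : om x y z = x 0 i30 * om (e i30) y z + x 0 i31 * om (e i31) y z
    + x 0 i32 * om (e i32) y z.
  by have [_ _ /scalar_expand3->] := lin y z.
have L2 x y z : om x y z = y 0 i30 * om x (e i30) z + y 0 i31 * om x (e i31) z
    + y 0 i32 * om x (e i32) z.
  by have [_ /scalar_expand3 E _] := lin x z; exact: E.
have L3 x y z : om x y z = z 0 i30 * om x y (e i30) + z 0 i31 * om x y (e i31)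
    + z 0 i32 * om x y (e i32).
  by have [/scalar_expand3-> _ _] := lin x y.
have A1 x y : om x x y = 0 by have [] := alt x y.
have A2 x y : om x y x = 0 by have [] := alt x y.
have A3 x y : om x y y = 0 by have [] := alt y x.
(* Antisymmetry by polarization of om(x + y, x + y, z) = 0; the factor 1 matches the shape a *: x +
   y of [scalar]. *)
have S1 x y z : om y x z = - om x y z.
  have := A1 (1 *: x + y) z; have [_ _ l1] := lin (1 *: x + y) z; rewrite l1 mul1r.
  have [_ l2 _] := lin x z; rewrite l2; have [_ l3 _] := lin y z; rewrite l3.
  by rewrite !A1 !mul1r; lra.
have S2 x y z : om x z y = - om x y z.
  have := A3 x (1 *: y + z); have [_ l1 _] := lin x (1 *: y + z); rewrite l1 mul1r.
  have [l2 _ _] := lin x y; rewrite l2; have [l3 _ _] := lin x z; rewrite l3.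
  by rewrite !A3 !mul1r; lra.
rewrite (L1 a b c) !(L2 _ b c) !(L3 _ _ c) !(A1, A2, A3) /coef3 /det3.
rewrite (S1 (e i30) (e i31)) (S2 (e i30) (e i31) (e i32)).
rewrite (S1 (e i30) (e i32)) (S2 (e i30) (e i31) (e i32)).
rewrite (S2 (e i31) (e i30) (e i32)) (S1 (e i30) (e i31)).
rewrite (S2 (e i32) (e i30) (e i31)) (S1 (e i30) (e i32)) (S2 (e i30) (e i31)).
by rewrite /e; ring.
Qed.

(** Three vectors in the plane ker l are dependent. *)
Lemma alternating3_ker om (l : 'rV[R]_3 -> R) a b c : alternating3 om ->
  scalar l -> (exists v, l v != 0) -> l a = 0 -> l b = 0 -> l c = 0 ->
  om a b c = 0.
Proof.
move=> /alternating3E -> sl [v lv].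
rewrite (scalar_expand3 sl a) (scalar_expand3 sl b) (scalar_expand3 sl c) => la lb lc.
suff -> : det3 a b c = 0 by rewrite mulr0.
apply: (mulIf lv); rewrite mul0r (scalar_expand3 sl v).
have L (X : R) : (forall i, l (e i) * X = 0) ->
    X * (v 0 i30 * l (e i30) + v 0 i31 * l (e i31) + v 0 i32 * l (e i32)) = 0.
  move=> H; transitivity (v 0 i30 * (l (e i30) * X) + v 0 i31 * (l (e i31) * X)
    + v 0 i32 * (l (e i32) * X)); first by ring.
  by rewrite !H; ring.
pose l' (x : 'rV[R]_3) :=
  x 0 i30 * l (e i30) + x 0 i31 * l (e i31) + x 0 i32 * l (e i32).
rewrite -/(l' a) -/(l' b) -/(l' c) in la lb lc.
(* Cramer's rule: l(e_i) times the determinant is the determinant whose i-th column is replaced by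
   (l a, l b, l c), expanded along that column. *)
apply: L; apply: ord3P.
- transitivity ((b 0 i31 * c 0 i32 - b 0 i32 * c 0 i31) * l' a
    - (a 0 i31 * c 0 i32 - a 0 i32 * c 0 i31) * l' b
    + (a 0 i31 * b 0 i32 - a 0 i32 * b 0 i31) * l' c).
    by rewrite /det3 /l'; ring.
  by rewrite la lb lc; ring.
- transitivity (- (b 0 i30 * c 0 i32 - b 0 i32 * c 0 i30) * l' a
    + (a 0 i30 * c 0 i32 - a 0 i32 * c 0 i30) * l' b
    - (a 0 i30 * b 0 i32 - a 0 i32 * b 0 i30) * l' c).
    by rewrite /det3 /l'; ring.
  by rewrite la lb lc; ring.
- transitivity ((b 0 i30 * c 0 i31 - b 0 i31 * c 0 i30) * l' a
    - (a 0 i30 * c 0 i31 - a 0 i31 * c 0 i30) * l' b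
    + (a 0 i30 * b 0 i31 - a 0 i31 * b 0 i30) * l' c).
    by rewrite /det3 /l'; ring.
  by rewrite la lb lc; ring.
Qed.

(** The form om n v vanishes on ker l and on n, hence everywhere. So n and v are proportional, and
    comparing their values under l gives v = 0. *)
Lemma alternating3_nondegenerate om (l : 'rV[R]_3 -> R) n v :
  alternating3 om -> (exists a b c, om a b c != 0) -> scalar l ->
  l n = 1 -> l v = 0 -> (forall w, l w = 0 -> om n v w = 0) -> v = 0.
Proof.
move=> alt [a [b [c abc]]] sl ln lv H.
have c0 : coef3 om != 0.
  by apply: contraNneq abc => E; rewrite alternating3E// E mul0r.
have D z : det3 n v z = 0.
  apply: (mulfI c0); rewrite mulr0 -alternating3E//.
  have [lin al] := alt; have [s3 _ _] := lin n v; have [_ al2 _] := al n v.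
  have : om n v (- l z *: n + z) = 0 by apply: H; rewrite sl ln; ring.
  by rewrite s3 al2 mulr0 add0r.
(* Testing against the basis vectors gives the components of the cross product of n and v. *)
have C i j : n 0 i * v 0 j = n 0 j * v 0 i.
  have := D (e i30); have := D (e i31); have := D (e i32).
  rewrite /det3 !mxE /=; move: j i.
  by apply: ord3P; apply: ord3P => //; lra.
apply/rowP => j; rewrite mxE.
have : l n * v 0 j = n 0 j * l v.
  rewrite (scalar_expand3 sl n) (scalar_expand3 sl v).
  transitivity (l (e i30) * (n 0 i30 * v 0 j) + l (e i31) * (n 0 i31 * v 0 j)
    + l (e i32) * (n 0 i32 * v 0 j)); first by ring.
  by rewrite !(C _ j); ring.
by rewrite ln lv mul1r mulr0.
Qed.

Section Normal.
Context {n : nat}.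
Implicit Types (b : 'rV[R]_n -> 'rV[R]_n -> R) (l : 'rV[R]_n -> R).

Definition gram b : 'M[R]_n := \matrix_(i, j) b (delta_mx 0 i) (delta_mx 0 j).
Definition covector l : 'rV[R]_n := \row_j l (delta_mx 0 j).

(* The solution v of l v = 1 that is b-orthogonal to the kernel of l. *)
Definition normal_vec b l : 'rV[R]_n :=
  let y := covector l *m \adj (gram b) in
  ((y *m (covector l)^T) 0 0)^-1 *: y.

Definition inner_product b : Prop :=
  [/\ forall v, scalar (b v), forall v w, b v w = b w v
    & forall v, v != 0 -> 0 < b v v].

Lemma covectorE l v : scalar l -> l v = (v *m (covector l)^T) 0 0.
Proof.
move=> sl; rewrite {1}(row_sum_delta v) scalar_sum// mxE.
by apply: eq_bigr => i _; rewrite !mxE.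
Qed.

Lemma gramE b v w : inner_product b -> b v w = (v *m gram b *m w^T) 0 0.
Proof.
move=> [sb bC _]; rewrite {1}(row_sum_delta w) scalar_sum// mxE.
apply: eq_bigr => i _; rewrite [_^T _ _]mxE mulrC; congr (_ * _).
rewrite bC {1}(row_sum_delta v) scalar_sum// mxE.
by apply: eq_bigr => j _; rewrite mxE bC.
Qed.

Lemma det_gram_neq0 b : inner_product b -> \det (gram b) != 0.
Proof.
move=> ib; apply/det0P => -[v v0 vG]; have [_ _ /(_ v v0)] := ib.
by rewrite gramE// vG mul0mx mxE ltxx.
Qed.

(** Here y is det(gram b) times the b-gradient of l. Using the adjugate keeps y polynomial in the
    data, so the only division in [normal_vec] is by l y; this is nonzero because b y y > 0 is a
    multiple of it. *)
Lemma normal_vec_key b l : inner_product b -> scalar l -> (exists v, l v != 0) ->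
  let y := covector l *m \adj (gram b) in
  (forall v, b y v = \det (gram b) * l v) /\ l y != 0.
Proof.
move=> ib sl [v0 lv0] y.
have by_ v : b y v = \det (gram b) * l v.
  rewrite gramE// /y -(mulmxA _ (\adj _)) mul_adj_mx mul_mx_scalar -scalemxAl mxE.
  congr (_ * _); rewrite [RHS]covectorE// !mxE.
  by apply: eq_bigr => i _; rewrite !mxE mulrC.
split=> //.
have y0 : y != 0.
  apply: contra_neq lv0 => y0; have := by_ v0; rewrite y0.
  have [sb bC _] := ib; rewrite bC scalar0// => /esym/eqP.
  by rewrite mulf_eq0 (negPf (det_gram_neq0 ib)) => /eqP.
have [_ _ /(_ y y0)] := ib; rewrite by_ => H.
by apply: contraTneq H => ->; rewrite mulr0 ltxx.
Qed.

Lemma scalarZ l (a : R) v : scalar l -> l (a *: v) = a * l v.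
Proof. by move=> sl; rewrite -[a *: v]addr0 sl scalar0// addr0. Qed.

Lemma normal_vec1 b l : inner_product b -> scalar l -> (exists v, l v != 0) ->
  l (normal_vec b l) = 1.
Proof.
move=> ib sl lv; have [_ ly] := normal_vec_key ib sl lv.
by rewrite /normal_vec scalarZ// -covectorE// mulVf.
Qed.

Lemma normal_vec_orthogonal b l v : inner_product b -> scalar l ->
  (exists v, l v != 0) -> l v = 0 -> b (normal_vec b l) v = 0.
Proof.
move=> ib sl lv lv0; have [by_ _] := normal_vec_key ib sl lv.
have [sb bC _] := ib.
by rewrite bC scalarZ// bC by_ lv0 !mulr0.
Qed.

(** The difference of two solutions lies in ker l, to which both are orthogonal; it is thus
    orthogonal to itself. *)
Lemma normal_vec_unique b l m : inner_product b -> scalar l -> l m = 1 ->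
  (forall v, l v = 0 -> b m v = 0) -> m = normal_vec b l.
Proof.
move=> ib sl lm bm.
have lv : exists v, l v != 0 by exists m; rewrite lm oner_neq0.
have [sb bC bp] := ib.
have E : -1 *: normal_vec b l + m = m - normal_vec b l by rewrite scaleN1r addrC.
have ld : l (m - normal_vec b l) = 0.
  by rewrite -E sl normal_vec1// lm mulN1r addNr.
have [/eqP|/bp] := eqVneq (m - normal_vec b l) 0; first by rewrite subr_eq0 => /eqP.
rewrite -[X in b _ X]E sb bC normal_vec_orthogonal// bC bm//.
by rewrite mulr0 addr0 ltxx.
Qed.

End Normal.
End LinearAlgebra.

(** * Coordinate changes *)

Lemma open_preimage_in (T U : topologicalType) (D : set T) (A : set U) (f : T -> U) :
  open D -> open A -> (forall x, D x -> {for x, continuous f}) ->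
  open (D `&` f @^-1` A).
Proof.
move=> oD oA cf; rewrite openE => x [Dx Ax].
apply: filterI; first exact: open_nbhs_nbhs.
by apply: (cf x Dx); exact: open_nbhs_nbhs.
Qed.

Section ManifoldCalculus.
Context {R : realType}.

Lemma near_eq_diff (V W : normedModType R) (f g : V -> W) x v :
  {near x, f =1 g} -> differentiable f x -> 'd g x v = 'd f x v.
Proof.
move=> fg df; have dg := near_eq_differentiable fg df.
by rewrite -!deriveE//; apply/esym/near_eq_derive.
Qed.

Lemma diff_comp_at (V W Z : normedModType R) (f : V -> W) (g : W -> Z) x y v :
  f x = y -> differentiable f x -> differentiable g y ->
  'd (g \o f) x v = 'd g y ('d f x v).
Proof. by move=> <- df dg; rewrite diff_comp. Qed.

Lemma differentiable_comp_at (V W Z : normedModType R) (f : V -> W) (g : W -> Z)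
  x y : f x = y -> differentiable f x -> differentiable g y ->
  differentiable (g \o f) x.
Proof. by move=> <-; exact: differentiable_comp. Qed.

Lemma smooth_differentiable (V W : normedModType R) (U : set V) (f : V -> W) x :
  smooth_on U f -> U x -> differentiable f x.
Proof. by move=> /(_ 1) [+ _] Ux; exact. Qed.

Lemma smooth_derive (V W : normedModType R) (U : set V) (f : V -> W) v :
  smooth_on U f -> smooth_on U ('D_v f).
Proof. by move=> sf k; have [_] := sf k.+1; exact. Qed.

Context {n : nat} {M : manifold R n}.
Implicit Types (p q r x : M) (U : set M).

Lemma dom_self p : dom p p. Proof. exact: mem_chart_at. Qed.

Lemma open_dom p : open (dom p : set M). Proof. exact: cdom_open. Qed.

Lemma coordK p x : dom p x -> param p (coord p x) = x.
Proof. exact: cmapK. Qed.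

Lemma coord_continuous_at p x : dom p x -> {for x, continuous (coord p)}.
Proof. exact: cmap_cont. Qed.

Lemma param_continuous_at p x : dom p x ->
  {for coord p x, continuous (@param R n M p)}.
Proof. by move=> px; apply: cinv_cont; exists x. Qed.

Lemma chart_imageP p U u : (coord p @` (dom p `&` U)) u <->
  (coord p @` dom p) u /\ U (param p u).
Proof.
split=> [[x [px Ux] <-]|[[x px <-]]]; last first.
  by rewrite coordK// => Ux; exists x.
by split; [exists x|rewrite coordK].
Qed.

Lemma open_chart_image p U : open U -> open (coord p @` (dom p `&` U)).
Proof.
move=> oU; rewrite openE => _ [x [px Ux] <-]; rewrite /interior.
have N1 : nbhs (coord p x) (coord p @` dom p).
  by apply: open_nbhs_nbhs; split; [exact: cimg_open|exists x].
have N2 : nbhs (coord p x) (param p @^-1` U).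
  apply: (param_continuous_at px); rewrite coordK//; exact: open_nbhs_nbhs.
by apply: filterS2 N1 N2 => u u1 u2; apply/chart_imageP.
Qed.

Lemma near_chart p x (P : set M) : dom p x -> nbhs x P ->
  \forall u \near coord p x,
    exists y, [/\ dom p y, P y, coord p y = u & param p u = y].
Proof.
move=> px; rewrite nbhsE => -[U [oU Ux] UP].
have : nbhs (coord p x) (coord p @` (dom p `&` U)).
  apply: open_nbhs_nbhs; split; first exact: open_chart_image.
  by exists x.
apply: filterS => _ [y [py Uy] <-]; exists y.
by split; rewrite ?coordK//; exact: UP.
Qed.

Lemma differentiable_transition p q x : dom p x -> dom q x ->
  differentiable (transition p q) (coord p x).
Proof.
move=> px qx; apply: (smooth_differentiable (@chart_compat _ _ M p q)).
by exists x.
Qed.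

Lemma diff_transition_comp p q r x v : dom p x -> dom q x -> dom r x ->
  'd (transition q r) (coord q x) ('d (transition p q) (coord p x) v) =
  'd (transition p r) (coord p x) v.
Proof.
move=> px qx rx.
have E : transition p q (coord p x) = coord q x by rewrite /transition /= coordK.
have d1 := differentiable_transition px qx.
have d2 := differentiable_transition qx rx.
have E2 := diff_comp_at v E d1 d2.
apply: (etrans (esym E2)); clear E2.
have d3 := differentiable_comp_at E d1 d2.
apply/esym; apply: (near_eq_diff v _ d3).
have nq : nbhs x (dom q) by apply: open_nbhs_nbhs; split => //; exact: open_dom.
apply: filterS (near_chart px nq) => _ [y [py qy <- Ey]].
by rewrite /transition /= Ey coordK.
Qed.

Lemma diff_transition_id p x v : dom p x ->
  'd (transition p p) (coord p x) v = v.
Proof.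
move=> px; rewrite (@near_eq_diff _ _ idfun).
- by rewrite diff_val.
- apply: filterS (near_chart px (@filterT _ _ _)) => _ [y [py _ <- Ey]].
  by rewrite /transition /= Ey.
- exact: ex_diff.
Qed.

Lemma tcoordK p x v : dom p x -> tvec p x (tcoord p x v) = v.
Proof.
by move=> px; rewrite /tvec /tcoord diff_transition_comp ?diff_transition_id//;
  exact: dom_self.
Qed.

Lemma tvecK p x v : dom p x -> tcoord p x (tvec p x v) = v.
Proof.
by move=> px; rewrite /tvec /tcoord diff_transition_comp ?diff_transition_id//;
  exact: dom_self.
Qed.

Lemma dfun_tvec (F : M -> R) p x v : smooth_fun F -> dom p x ->
  dfun F x (tvec p x v) = 'd (F \o param p) (coord p x) v.
Proof.
move=> sF px; rewrite /dfun /tvec; have xx := dom_self x.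
have E : transition p x (coord p x) = coord x x by rewrite /transition /= coordK.
have d1 := differentiable_transition px xx.
have d2 : differentiable (F \o param x) (coord x x).
  by apply: (smooth_differentiable (sF x)); exists x.
have E2 := diff_comp_at v E d1 d2.
apply: (etrans (esym E2)); clear E2.
have d3 := differentiable_comp_at E d1 d2.
apply/esym; apply: (near_eq_diff v _ d3).
have nq : nbhs x (dom x) by apply: open_nbhs_nbhs; split => //; exact: open_dom.
apply: filterS (near_chart px nq) => _ [y [py qy <- Ey]].
by rewrite /transition /= Ey coordK.
Qed.

Lemma curve_coord_change (c : R -> M) p q (t : R) : {for t, continuous c} ->
  dom p (c t) -> dom q (c t) -> differentiable (coord p \o c) t ->
  differentiable (coord q \o c) t /\
  'D_1 (coord q \o c) t = 'd (transition p q) (coord p (c t)) ('D_1 (coord p \o c) t).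
Proof.
move=> cc pc qc dp.
have d2 := differentiable_transition pc qc.
have N : \forall s \near t, (transition p q \o (coord p \o c)) s = (coord q \o c) s.
  have nc : nbhs (c t) (dom p).
    by apply: open_nbhs_nbhs; split => //; exact: open_dom.
  have H : nbhs t (c @^-1` dom p) by exact: (cc _ nc).
  apply: filterS H => s ps.
  by rewrite /transition /= coordK.
have E : (coord p \o c) t = coord p (c t) by [].
have dc' := differentiable_comp_at E dp d2.
have dc := near_eq_differentiable N dc'.
split=> //; rewrite (deriveE _ dc) (near_eq_diff _ N dc') (deriveE _ dp).
exact: (diff_comp_at _ E dp d2).
Qed.

(** The chart used by [velocity] moves with t; this computes it in a fixed chart, where it can be
    differentiated again. *)
Lemma velocityE (c : R -> M) q (t : R) : {for t, continuous c} ->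
  dom q (c t) -> differentiable (coord q \o c) t ->
  velocity c t = tvec q (c t) ('D_1 (coord q \o c) t).
Proof.
move=> cc qc dq; rewrite /velocity derive1E.
by have [_] := curve_coord_change cc qc (dom_self _) dq.
Qed.

Lemma curve_differentiable (J : set R) (c : R -> M) q (t : R) :
  smooth_map_to J c -> J t -> dom q (c t) ->
  {for t, continuous c} /\ differentiable (coord q \o c) t.
Proof.
move=> [cc sc] Jt qc; split; first exact: cc.
by apply: (smooth_differentiable (sc q)).
Qed.

End ManifoldCalculus.

(** * The normalized gradient *)

Section SmoothMatrix.
Context {R : realType}.

Lemma Ck_on_det (V : normedModType R) m k (U : set V) (A : V -> 'M[R]_m) :
  open U -> (forall i j, Ck_on k U (fun x => A x i j)) ->
  Ck_on k U (fun x => \det (A x)).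
Proof.
move=> oU H; rewrite /determinant; apply: Ck_on_sum => // s _.
apply: Ck_onM => //; first exact: Ck_on_cst.
by apply: Ck_on_prod.
Qed.

Lemma Ck_on_adj (V : normedModType R) m k (U : set V) (A : V -> 'M[R]_m) i j :
  open U -> (forall i j, Ck_on k U (fun x => A x i j)) ->
  Ck_on k U (fun x => (\adj (A x)) i j).
Proof.
move=> oU H.
have -> : (fun x => (\adj (A x)) i j) =
    (fun x => (-1) ^+ (j + i) * \det (row' j (col' i (A x)))).
  by apply/funext => x; rewrite mxE.
apply: Ck_onM => //; first exact: Ck_on_cst.
apply: Ck_on_det => // a b.
have -> : (fun x => row' j (col' i (A x)) a b) =
    (fun x => A x (lift j a) (lift i b)).
  by apply/funext => x; rewrite !mxE.
exact: H.
Qed.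

Lemma Ck_on_normal_vec (V : normedModType R) m k (U : set V)
    (b : V -> 'rV[R]_m -> 'rV[R]_m -> R) (l : V -> 'rV[R]_m -> R) : open U ->
  (forall x, U x -> inner_product (b x)) ->
  (forall x, U x -> scalar (l x)) ->
  (forall x, U x -> exists v, l x v != 0) ->
  (forall v w, Ck_on k U (fun x => b x v w)) ->
  (forall v, Ck_on k U (fun x => l x v)) ->
  Ck_on k U (fun x => normal_vec (b x) (l x)).
Proof.
move=> oU ib sl nl sb sml.
have Hy i : Ck_on k U (fun x => (covector (l x) *m \adj (gram (b x))) 0 i).
  have -> : (fun x => (covector (l x) *m \adj (gram (b x))) 0 i) =
      (fun x => \sum_j l x (delta_mx 0 j) * (\adj (gram (b x))) j i).
    by apply/funext => x; rewrite mxE; apply: eq_bigr => j _; rewrite [covector _ _ _]mxE.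
  apply: Ck_on_sum => // j _; apply: Ck_onM => //.
  apply: Ck_on_adj => // a c.
  have -> : (fun x => gram (b x) a c) = (fun x => b x (delta_mx 0 a) (delta_mx 0 c)).
    by apply/funext => x; rewrite mxE.
  exact: sb.
apply: Ck_on_rV => // i.
have -> : (fun x => normal_vec (b x) (l x) 0 i) = (fun x =>
    (((covector (l x) *m \adj (gram (b x))) *m (covector (l x))^T) 0 0)^-1 *
    (covector (l x) *m \adj (gram (b x))) 0 i).
  by apply/funext => x; rewrite /normal_vec mxE.
apply: Ck_onM => //; apply: Ck_onV => //.
  move=> x Ux; have [_ +] := normal_vec_key (ib x Ux) (sl x Ux) (nl x Ux).
  by rewrite covectorE//; exact: sl.
have -> : (fun x => ((covector (l x) *m \adj (gram (b x))) *m (covector (l x))^T) 0 0) =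
    (fun x => \sum_j (covector (l x) *m \adj (gram (b x))) 0 j * l x (delta_mx 0 j)).
  apply/funext => x; rewrite mxE; apply: eq_bigr => j _.
  by rewrite [(covector _)^T _ _]mxE [covector _ _ _]mxE.
by apply: Ck_on_sum => // j _; exact: Ck_onM.
Qed.

End SmoothMatrix.

Section NormalField.
Context {R : realType} {n : nat} {M : manifold R n}.
Variables (F : M -> R) (smF : smooth_fun F).
Variables (W : set M) (openW : open W).
Variables (g : M -> 'rV[R]_n -> 'rV[R]_n -> R) (metg : riemannian_metric W g).

Definition normal_field (x : M) : 'rV[R]_n := normal_vec (g x) (dfun F x).

Lemma dfun_scalar (x : M) : scalar (dfun F x).
Proof. by move=> a u v; rewrite /dfun linearP. Qed.

Lemma metric_inner_product (x : M) : W x -> inner_product (g x).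
Proof. by case: metg => H1 H2 H3 _ Wx; split; [exact: H1|exact: H2|exact: H3]. Qed.

Lemma metric_in_inner_product (p x : M) : dom p x -> W x ->
  inner_product (metric_in p g (coord p x)).
Proof.
move=> px Wx; have [H1 H2 H3] := metric_inner_product Wx.
rewrite /metric_in coordK//; split.
- by move=> v a u w; rewrite /tvec linearP H1.
- by move=> v w; rewrite H2.
- move=> v v0; apply: H3; apply: contra_neq v0 => E.
  by rewrite -(tvecK v px) E /tcoord linear0.
Qed.

(** The two defining properties of the normal vector are preserved by the change of coordinates, so
    uniqueness identifies its chart expression. Smoothness then becomes a question about explicit
    coordinate formulas. *)
Lemma field_in_normal (p x : M) : dom p x -> W x ->
  (exists v, dfun F x v != 0) ->
  field_in p normal_field (coord p x) =
  normal_vec (metric_in p g (coord p x)) ('d (F \o param p) (coord p x)).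
Proof.
move=> px Wx nz; have ip := metric_inner_product Wx.
apply: normal_vec_unique.
- exact: metric_in_inner_product.
- by move=> a u v; rewrite linearP.
- by rewrite /field_in coordK// -dfun_tvec// tcoordK// normal_vec1//; exact: dfun_scalar.
- move=> v; rewrite -dfun_tvec// /field_in /metric_in coordK// tcoordK// => lv.
  by apply: normal_vec_orthogonal => //; exact: dfun_scalar.
Qed.

Lemma smooth_normal_field (U : set M) : open U -> U `<=` W ->
  (forall x, U x -> exists v, dfun F x v != 0) -> smooth_field U normal_field.
Proof.
move=> oU UW nz p k; have oI := open_chart_image (p := p) oU.
apply: (Ck_on_ext oI (f := fun u => normal_vec (metric_in p g u) (fun v => 'D_v (F \o param p) u))).
  move=> _ [x [px Ux] <-]; rewrite field_in_normal; [|exact: px|exact: UW|exact: nz].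
  congr normal_vec; apply/funext => v; apply: deriveE.
  by apply: (smooth_differentiable (smF p)); exists x.
have sub : coord p @` (dom p `&` U) `<=` coord p @` dom p.
  by move=> _ [x [px _] <-]; exists x.
have dE x v : dom p x -> 'D_v (F \o param p) (coord p x) = 'd (F \o param p) (coord p x) v.
  by move=> px; apply: deriveE; apply: (smooth_differentiable (smF p)); exists x.
apply: Ck_on_normal_vec => //.
- by move=> _ [x [px Ux] <-]; apply: metric_in_inner_product => //; exact: UW.
- by move=> _ [x [px Ux] <-] a u v; rewrite !dE// linearP.
- move=> _ [x [px Ux] <-]; have [v vx] := nz x Ux.
  by exists (tcoord p x v); rewrite dE// -dfun_tvec// tcoordK.
- move=> v w; have [_ _ _ /(_ p v w k)] := metg; apply: Ck_on_sub.
  by move=> _ [x [px Ux] <-]; exists x => //; split => //; exact: UW.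
- by move=> v; apply: Ck_on_sub (smooth_derive v (smF p) k).
Qed.

Lemma regular_neighborhood (p : M) : W p -> (exists v, dfun F p v != 0) ->
  exists U : set M, [/\ open U, U p, U `<=` W &
    forall x, U x -> exists v, dfun F x v != 0].
Proof.
move=> Wp [v vp]; pose f := F \o param p.
have dE x w : dom p x -> 'D_w f (coord p x) = dfun F x (tvec p x w).
  move=> px; rewrite dfun_tvec//; apply: deriveE.
  by apply: (smooth_differentiable (smF p)); exists x.
(* The direction v is kept constant in the chart at p, so openness only uses the continuity of one
   derivative. *)
exists (W `&` [set x | dom p x /\ 'D_v f (coord p x) != 0]); split.
- apply: openI => //; rewrite openE => x /= [px nz]; rewrite /interior.
  have np : nbhs x (dom p) by apply: open_nbhs_nbhs; split => //; exact: open_dom.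
  have c : {for x, continuous ('D_v f \o coord p)}.
    apply: continuous_comp; first exact: coord_continuous_at.
    by apply: (smooth_derive v (smF p) 0); exists x.
  have nn : \forall y \near x, 'D_v f (coord p y) != 0.
    by apply: (cvgr_neq0 _ c).
  by apply: filterS2 np nn.
- split=> //; split; first exact: dom_self.
  rewrite dE; last exact: dom_self.
  by rewrite /tvec diff_transition_id//; exact: dom_self.
- by move=> x [].
- by move=> x [_ [px]]; rewrite dE// => H; exists (tvec p x v).
Qed.

End NormalField.

(** * Tangent spaces of a regular level *)

Section LevelSet.
Context {R : realType} {n : nat} {M : manifold R n}.
Variables (F : M -> R) (smF : smooth_fun F).

Lemma diff_level (V : normedModType R) (f : V -> R) (c : R -> V) (t : R) (a : R) :
  differentiable c t -> differentiable f (c t) ->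
  (\forall s \near t, f (c s) = a) -> 'd f (c t) ('D_1 c t) = 0.
Proof.
move=> dc df N; rewrite (deriveE _ dc) -(diff_comp_at _ erefl dc df).
have N' : \forall s \near t, (f \o c) s = cst a s by [].
have E := near_eq_diff (1 : R) N' (differentiable_comp dc df).
by rewrite -E diff_cst.
Qed.

Lemma dfun_level (c : R -> M) (p : M) (t a : R) :
  {for t, continuous c} -> dom p (c t) -> differentiable (coord p \o c) t ->
  (\forall s \near t, F (c s) = a) ->
  'd (F \o param p) (coord p (c t)) ('D_1 (coord p \o c) t) = 0.
Proof.
move=> cc pc dc N; apply: (diff_level (c := coord p \o c) (a := a)) => //.
  by apply: (smooth_differentiable (smF p)); exists (c t).
have nc : nbhs (c t) (dom p).
  by apply: open_nbhs_nbhs; split => //; exact: open_dom.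
have H : nbhs t (c @^-1` dom p) by exact: (cc _ nc).
by apply: filterS2 H N => s ps <- /=; rewrite coordK.
Qed.

Lemma tangent_dfun (S : set M) (a : R) (p : M) v : S `<=` [set x | F x = a] ->
  tangent S p v -> dfun F p v = 0.
Proof.
move=> SL [c [[J [oJ J0 sc c0 cS]] <-]].
have [cc dc] := curve_differentiable sc J0 (dom_self (c 0)).
rewrite /velocity derive1E -c0 /dfun; apply: (dfun_level (a := a)) => //; first exact: dom_self.
have nJ : nbhs (0 : R) J by apply: open_nbhs_nbhs.
by apply: filterS nJ => s Js; apply: SL; exact: cS.
Qed.

(** The curve with velocity w comes from [level_curve] in the chart at p, with e as the transversal
    direction. It stays in S, and not merely in the level, because the image of an interval is
    connected and contains p. *)
Lemma level_tangent (a : R) (S : set M) (p : M) e w :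
  component_of [set x | F x = a] S -> S p ->
  dfun F p e = 1 -> dfun F p w = 0 -> tangent S p w.
Proof.
move=> [p0 Fp0 SE] Sp fe fw.
have SC : S = connected_component [set x | F x = a] p.
  by rewrite SE; apply: same_connected_component; rewrite -SE.
have Fp : F p = a by move: Sp; rewrite SE => /connected_component_sub.
set f := F \o param p; set u0 := coord p p; set U := coord p @` dom p.
have oU : open U by exact: cimg_open.
have Uu0 : U u0 by exists p => //; exact: dom_self.
have df : differentiable f u0 := smooth_differentiable (smF p) Uu0.
have fe' : 'D_e f u0 = 1 by rewrite deriveE.
have fw' : 'D_w f u0 = 0 by rewrite deriveE.
have [d [s [d0 s0 ss ds Hs]]] := level_curve oU (smF p) Uu0 fe' fw'.
pose y (t : R) := u0 + t *: w + s t *: e.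
have oJ : open (ball (0 : R) d) by exact: ball_open.
have J0 : ball (0 : R) d 0 by exact: ballxx.
have sy : smooth_on (ball (0 : R) d) y.
  move=> k; apply: Ck_onD => //; last exact: Ck_on_scalel.
  apply: Ck_onD => //; first exact: Ck_on_cst.
  apply: Ck_on_scalel => //.
  apply: (@Ck_on_lin _ _ _ _ _ (idfun : {linear R -> R})) => x; exact: cvg_id.
have yU t : ball (0 : R) d t -> U (y t) by move=> /Hs[].
have Fy t : ball (0 : R) d t -> F (param p (y t)) = a.
  by move=> /Hs[_ E]; rewrite -Fp -[in RHS](coordK (dom_self p)).
have cc t : ball (0 : R) d t -> {for t, continuous (param p \o y)}.
  move=> Jt; apply: continuous_comp; first exact: (sy 0).
  by have [x px <-] := yU t Jt; exact: param_continuous_at.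
have py0 : param p (y 0) = p.
  by rewrite /y s0 !scale0r !addr0 coordK//; exact: dom_self.
exists (param p \o y); split.
  exists (ball (0 : R) d); split => //.
    split=> // q k.
    have oD : open (ball (0 : R) d `&` (param p \o y) @^-1` dom q).
      by apply: open_preimage_in => //; exact: open_dom.
    have oI : open (coord p @` (dom p `&` dom q)).
      exact/open_chart_image/open_dom.
    apply: (Ck_on_comp_rV (f := y) (g := transition p q) oD oI).
    - by move=> t [/yU Ut qt]; apply/chart_imageP.
    - by apply: Ck_on_sub (sy k) => t [].
    - exact: chart_compat.
  move=> t Jt; rewrite SC.
  have H : connected ((param p \o y) @` ball (0 : R) d).
    apply: connected_continuous_connected.
      by rewrite ball_itv; apply/connected_intervalP; exact: interval_is_interval.
    by apply: continuous_in_subspaceT => u; rewrite inE; exact: cc.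
  apply: (connected_component_max _ _ H); last by exists t.
    by exists 0 => //=; rewrite py0.
  by move=> _ [u Ju <-] /=; exact: Fy.
rewrite /velocity derive1E /= py0.
have N : \forall t \near (0 : R), y t = (coord p \o (param p \o y)) t.
  have nJ : nbhs (0 : R) (ball (0 : R) d) by exact: open_nbhs_nbhs.
  by apply: filterS nJ => t /yU [x px xE] /=; rewrite -xE coordK.
rewrite -(near_eq_derive _ N) /y.
have i1 : is_derive (0 : R) 1 (fun t : R => t *: w) w.
  apply: DeriveDef; first exact/diff_derivable/differentiableZl.
  rewrite derive_scalel//.
  by rewrite derive_id scale1r.
have i2 : is_derive (0 : R) 1 (fun t : R => s t *: e) 0.
  have dfs : differentiable s 0 by apply: (smooth_differentiable ss).
  apply: DeriveDef; first exact/diff_derivable/differentiableZl.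
  by rewrite derive_scalel// derive_val scale0r.
have := is_deriveD (is_deriveD (is_derive_cst u0 (0 : R) (1 : R)) i1) i2.
by rewrite add0r addr0 => -[].
Qed.

End LevelSet.

(** * Nondegeneracy of the contracted form *)

Section Nondegenerate.
Context {R : realType} {M : manifold R 3}.

Lemma normal_contraction_nondegenerate
    (Om : M -> 'rV[R]_3 -> 'rV[R]_3 -> 'rV[R]_3 -> R) (F : M -> R) (a : R)
    (S : set M) (n : M -> 'rV[R]_3) :
  volume_form Om -> smooth_fun F -> component_of [set x | F x = a] S ->
  (forall p, S p -> dfun F p (n p) = 1) ->
  nondegenerate_on S (fun p v w => Om p (n p) v w).
Proof.
move=> [[lin alt _] nz] smF compS n1 p Sp v tv H.
have SL : S `<=` [set x | F x = a].
  by case: compS => p0 _ ->; exact: connected_component_sub.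
have altp : alternating3 (Om p) by split.
apply: (alternating3_nondegenerate (l := dfun F p) altp (nz p) _ (n1 p Sp)).
- exact: dfun_scalar.
- exact: tangent_dfun SL tv.
- by move=> w lw; apply: H; exact: level_tangent compS Sp (n1 p Sp) lw.
Qed.

End Nondegenerate.

(** * Hessians, brackets and derivatives of determinants *)

Section SecondOrder.
Context {R : realType}.

Lemma derive_swap_rV (V : normedModType R) n (f : V -> 'rV[R]_n) (U : set V)
    (x v w : V) :
  open U -> U x -> Ck_on 2 U f -> 'D_v ('D_w f) x = 'D_w ('D_v f) x.
Proof.
move=> oU Ux Hf; have [df Hf1] := Hf; apply/rowP => i.
have d1 z y : U y -> derivable f y z by move=> /df; exact: diff_derivable.
have d2 z z' y : U y -> derivable ('D_z f) y z'.
  by move=> Uy; have [/(_ y Uy) + _] := Hf1 z; exact: diff_derivable.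
have E z z' : 'D_z ('D_z' (fun y => f y 0 i)) x = 'D_z ('D_z' f) x 0 i.
  rewrite -derive_coord; last exact: d2.
  apply: near_eq_derive; have nU : nbhs x U by exact: open_nbhs_nbhs.
  by apply: filterS nU => y Uy; rewrite derive_coord//; exact: d1.
apply: (etrans (esym (E v w))); apply: (etrans _ (E w v)).
exact: (derive_swap _ _ oU Ux (Ck_on_coord i oU Hf)).
Qed.

Lemma diff_row_sum n (f : 'rV[R]_n -> R) u v : differentiable f u ->
  'd f u v = \sum_i v 0 i * 'D_(delta_mx 0 i) f u.
Proof.
move=> df; rewrite {1}(row_sum_delta v) linear_sum; apply: eq_bigr => i _.
by rewrite linearZ deriveE.
Qed.

(** With the partial derivatives of f as A, this product rule trades derivatives of the field Z for
    the Hessian of f. *)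
Lemma derive_pairing n (A : 'I_n -> 'rV[R]_n -> R) (Z : 'rV[R]_n -> 'rV[R]_n)
    (u w : 'rV[R]_n) (a : R) :
  (forall i, differentiable (A i) u) -> differentiable Z u ->
  (\forall x \near u, \sum_i Z x 0 i * A i x = a) ->
  \sum_i 'D_w Z u 0 i * A i u = - \sum_i Z u 0 i * 'D_w (A i) u.
Proof.
move=> dA dZ N; apply/eqP; rewrite -subr_eq0 opprK -big_split /=; apply/eqP.
have dZi i : differentiable (fun x => Z x 0 i) u by exact: differentiable_coord_comp.
transitivity ('D_w (cst a) u : R); last by rewrite derive_cst.
transitivity ('D_w (\sum_i ((fun x => Z x 0 i) * A i)) u); last first.
  by apply: near_eq_derive; apply: filterS N => x <-; rewrite fct_sumE.
rewrite derive_sum => [|i]; last by apply: derivableM; exact: diff_derivable.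
apply: eq_bigr => i _; rewrite deriveM; try exact: diff_derivable.
rewrite derive_coord; last exact: diff_derivable.
by rewrite /GRing.scale/= addrC; congr (_ + _); rewrite mulrC.
Qed.

(* That is, dF([Y, N]) = Y(dF(N)) - N(dF(Y)) = 0. *)
Lemma diff_bracket n (f : 'rV[R]_n -> R) (U : set 'rV[R]_n)
    (Y N : 'rV[R]_n -> 'rV[R]_n) (u : 'rV[R]_n) (a b : R) :
  open U -> U u -> smooth_on U f -> differentiable Y u -> differentiable N u ->
  (\forall x \near u, 'd f x (Y x) = a) -> (\forall x \near u, 'd f x (N x) = b) ->
  'd f u ('D_(Y u) N u) = 'd f u ('D_(N u) Y u).
Proof.
move=> oU Uu sf dY dN hY hN.
have df x : U x -> differentiable f x by exact: smooth_differentiable.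
pose A (i : 'I_n) := 'D_(delta_mx 0 i) f.
have dA i : differentiable (A i) u.
  exact: (smooth_differentiable (smooth_derive _ sf)).
have near Z c : (\forall x \near u, 'd f x (Z x) = c) ->
    \forall x \near u, \sum_i Z x 0 i * A i x = c.
  have nU : nbhs u U by exact: open_nbhs_nbhs.
  move=> h; apply: filterS2 nU h => x /df dfx <-.
  by rewrite diff_row_sum.
(* The Hessian of f at u. The two sides of the goal are -S(N, Y) and -S(Y, N). *)
pose S (z w : 'rV[R]_n) :=
  \sum_i \sum_j z 0 i * (w 0 j * 'D_(delta_mx 0 j) (A i) u).
have ES (z w : 'rV[R]_n) : \sum_i z 0 i * 'D_w (A i) u = S z w.
  apply: eq_bigr => i _.
  by rewrite (deriveE _ (dA i)) (diff_row_sum _ (dA i)) mulr_sumr.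
have SC (z w : 'rV[R]_n) : S z w = S w z.
  rewrite /S exchange_big; apply: eq_bigr => j _; apply: eq_bigr => i _.
  have -> : 'D_(delta_mx 0 j) (A i) u = 'D_(delta_mx 0 i) (A j) u.
    exact: derive_swap oU Uu (sf 2).
  ring.
have dfu := df u Uu.
rewrite (diff_row_sum _ dfu) [RHS](diff_row_sum _ dfu).
apply: (etrans (derive_pairing (Y u) dA dN (near _ _ hN))).
apply: (etrans _ (esym (derive_pairing (N u) dA dY (near _ _ hY)))).
exact: (congr1 -%R (etrans (ES _ _) (etrans (SC _ _) (esym (ES _ _))))).
Qed.

Lemma is_derive_det3 (a b c : R -> 'rV[R]_3) (t : R) :
  differentiable a t -> differentiable b t -> differentiable c t ->
  is_derive t 1 (fun s => det3 (a s) (b s) (c s))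
    (det3 ('D_1 a t) (b t) (c t) + det3 (a t) ('D_1 b t) (c t)
     + det3 (a t) (b t) ('D_1 c t)).
Proof.
move=> da db dc.
have H (x : R -> 'rV[R]_3) i : differentiable x t ->
    is_derive t 1 (fun s => x s 0 i) ('D_1 x t 0 i).
  move=> dx; have dxi := differentiable_coord_comp i dx.
  apply: DeriveDef; first exact: diff_derivable.
  by rewrite derive_coord//; exact: diff_derivable.
have Ha i := H a i da; have Hb i := H b i db; have Hc i := H c i dc.
have P (u v : R -> R) u' v' : is_derive t 1 u u' -> is_derive t 1 v v' ->
    is_derive t 1 (fun s => u s * v s) (u' * v t + u t * v').
  move=> du dv; apply: is_derive_eq (is_deriveM du dv) _.
  by rewrite /GRing.scale/= addrC (mulrC (v t)).
have S (u v : R -> R) u' v' : is_derive t 1 u u' -> is_derive t 1 v v' ->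
    is_derive t 1 (fun s => u s - v s) (u' - v').
  by move=> du dv; exact: is_deriveB.
have D (u v : R -> R) u' v' : is_derive t 1 u u' -> is_derive t 1 v v' ->
    is_derive t 1 (fun s => u s + v s) (u' + v').
  by move=> du dv; exact: is_deriveD.
have B i j := S _ _ _ _ (P _ _ _ _ (Hb i) (Hc j)) (P _ _ _ _ (Hb j) (Hc i)).
apply: is_derive_eq (D _ _ _ _ (S _ _ _ _ (P _ _ _ _ (Ha i30) (B i31 i32))
  (P _ _ _ _ (Ha i31) (B i30 i32))) (P _ _ _ _ (Ha i32) (B i30 i31))) _.
move: ('D_1 a t) ('D_1 b t) ('D_1 c t) (a t) (b t) (c t) => a' b' c' x y z.
by rewrite /det3; ring.
Qed.

End SecondOrder.

(** * Variations of the flow *)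

Lemma Ck_on_comp_snd (R : realType) (W : normedModType R) k
    (J : set R) (g : R -> R) : open J ->
  Ck_on k J g -> Ck_on k [set z : (W * R)%type | J z.2] (g \o snd).
Proof.
move=> oJ Hg.
have E (z : W * R) : z.2 = \sum_(i < 1) z.2 *: (1 : R).
  by rewrite big_ord1 [RHS]mulr1.
have -> : g \o snd = fun z : W * R => g (\sum_(i < 1) z.2 *: (1 : R)).
  by apply/funext => z /=; rewrite -E.
have oD : open [set z : (W * R)%type | J z.2].
  by apply: (@open_comp _ _ snd) => // z _; exact: cvg_snd.
apply: Ck_on_comp_span Hg => // [z Jz|i]; first by rewrite -E.
by apply: (@Ck_on_lin _ _ _ _ _ (snd : {linear (W * R)%type -> R})) => z; exact: cvg_snd.
Qed.

Section FlowVariation.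
Context {R : realType} {n : nat} {M : manifold R n}.
Variables (X : M -> 'rV[R]_n) (S : set M) (phi : R -> M -> M).
Hypothesis flow : flow_on S X phi.

(** Near (t0, 0) the map G is the smooth extension supplied by [smooth_family_on], composed with (t,
    s) -> (t, coord p (c s)). The set D is where this composite is defined and lands in the chart at
    q. *)
Lemma flow_variation (p q : M) (c : R -> M) (t0 : R) :
  S p -> curve_through S p c -> dom q (phi t0 p) ->
  let G (z : R * R) := phi z.1 (c z.2) in
  exists D : set (R * R), [/\ open D, D (t0, 0),
    forall z, D z -> [/\ S (c z.2), dom q (G z) & {for z, continuous G}] &
    smooth_on D (coord q \o G)].
Proof.
move=> Sp [J [oJ J0 [cc sc] c0 cS]] qp G.
have [_ _ _ smphi _] := flow.
have [U [Phi [oU Up [cPhi sPhi] phiE]]] := smphi t0 p Sp.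
have oJ' : open (J `&` c @^-1` dom p).
  by apply: open_preimage_in => //; exact: open_dom.
pose k (z : R * R) : (R * 'rV[R]_n)%type := (z.1, coord p (c z.2)).
pose D1 := [set z : (R * R)%type | (J `&` c @^-1` dom p) z.2].
have oD1 : open D1 by apply: (@open_comp _ _ snd) => // z _; exact: cvg_snd.
(* Coordinates of k z in the basis e of R * 'rV_n, index 0 being time and the lifted indices space;
   this is the form required by [Ck_on_comp_span]. *)
pose l (i : 'I_n.+1) (z : R * R) : R :=
  if unlift ord0 i is Some j then coord p (c z.2) 0 j else z.1.
pose e (i : 'I_n.+1) : (R * 'rV[R]_n)%type :=
  if unlift ord0 i is Some j then (0, delta_mx 0 j) else (1, 0).
have kE z : k z = \sum_i l i z *: e i.
  rewrite big_ord_recl /l /e unlift_none.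
  under eq_bigr do rewrite liftK.
  rewrite [RHS]surjective_pairing /k; congr (_, _).
    rewrite raddfD (raddf_sum fst) big1 ?addr0 /= ?[RHS]mulr1// => j _.
    exact: mulr0.
  rewrite raddfD (raddf_sum snd) /= scaler0 add0r.
  exact: row_sum_delta.
have sl i m : Ck_on m D1 (l i).
  rewrite /l; case: (unlift ord0 i) => [j|].
    have H := Ck_on_coord j oJ' (sc p m).
    have H' := @Ck_on_comp_snd R R m _ _ oJ' H.
    exact: H'.
  by apply: (@Ck_on_lin _ _ _ _ _ (fst : {linear (R * R)%type -> R})) => z; exact: cvg_fst.
have ck z : D1 z -> {for z, continuous k}.
  move=> D1z; have -> : k = fun z => \sum_i l i z *: e i by apply/funext.
  exact: (@Ck_on_sum R _ _ 0 D1 _ (index_enum _) xpredT (fun i z => l i z *: e i)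
    oD1 (fun i _ => Ck_on_scalel (e i) oD1 (sl i 0%N))).
have oV : open (U `&` Phi @^-1` dom q).
  by apply: open_preimage_in => //; exact: open_dom.
pose D := D1 `&` k @^-1` (U `&` Phi @^-1` dom q).
have oD : open D by exact: open_preimage_in.
have GE z : D z -> G z = Phi (k z).
  by move=> [[Jz pz] [Uz _]]; apply: phiE => //; exact: cS.
have D0 : D (t0, 0).
  have pc : dom p (c 0) by rewrite c0; exact: dom_self.
  have Uk : U (k (t0, 0)) by rewrite /k /= c0.
  split=> //; split=> //=.
  have <- : phi t0 (c 0) = Phi (k (t0, 0)) by apply: phiE => //; exact: cS.
  by rewrite c0.
exists D; split => // [z Dz|m].
  have [[Jz pz] [Uz qz]] := Dz; split; first exact: cS.
    by rewrite (GE z Dz).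
  have N : \forall y \near z, (Phi \o k) y = G y.
    have nD : nbhs z D by exact: open_nbhs_nbhs.
    by apply: filterS nD => y /GE.
  rewrite /prop_for /= /continuous_at (GE z Dz).
  apply: cvg_trans (near_eq_cvg N) _.
  exact: (continuous_comp (ck z (conj Jz pz)) (cPhi (k z) Uz)).
apply: (Ck_on_ext oD (f := (coord q \o Phi) \o k)).
  by move=> z Dz /=; rewrite (GE z Dz).
apply: Ck_on_rV => // j.
have -> : (fun x => ((coord q \o Phi) \o k) x 0 j) =
    (fun z => (fun y => (coord q \o Phi) y 0 j) (\sum_i l i z *: e i)).
  by apply/funext => z /=; rewrite kE.
apply: (@Ck_on_comp_span R _ _ _ m D _ l e _ oD _ _ (Ck_on_coord j oV (sPhi q m))).
- by move=> z [_]; rewrite /= kE.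
- by move=> i; apply: Ck_on_sub (sl i m) => z [].
Qed.

Lemma velocity_line (V : normedModType R) (D : set V) (q : M) (G : V -> M)
    (x v : V) (h : R) : D (x + h *: v) -> {for x + h *: v, continuous G} ->
  dom q (G (x + h *: v)) -> smooth_on D (coord q \o G) ->
  velocity (fun h => G (x + h *: v)) h =
  tvec q (G (x + h *: v)) ('D_v (coord q \o G) (x + h *: v)).
Proof.
move=> Dz cG qz sG.
have cl : {for h, continuous (fun h : R => x + h *: v)}.
  by apply: cvgD; [exact: cvg_cst|apply: cvgZr_tmp; exact: cvg_id].
have dl : differentiable (fun h : R => x + h *: v) h.
  by apply: differentiableD; [exact: differentiable_cst|exact: differentiableZl].
have cc := continuous_comp (f := fun h : R => x + h *: v) (g := G) cl cG.
have dc : differentiable (coord q \o (fun h : R => G (x + h *: v))) h.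
  apply: (differentiable_comp (f := fun h : R => x + h *: v) (g := coord q \o G)) => //.
  exact: smooth_differentiable sG Dz.
exact: (etrans (velocityE cc qz dc) (congr1 (tvec q (G (x + h *: v)))
  (derive_line (coord q \o G) x v h))).
Qed.

Lemma line1 (t s : R) : (0, s) + t *: (1, 0) = (t, s) :> (R * R)%type.
Proof. by congr (_, _); rewrite /= ?add0r ?[LHS]mulr1// [t *: 0]mulr0 addr0. Qed.

Lemma line2 (t s : R) : (t, 0) + s *: (0, 1) = (t, s) :> (R * R)%type.
Proof. by congr (_, _); rewrite /= ?add0r ?[LHS]mulr1// [s *: 0]mulr0 addr0. Qed.

Section OnDomain.
Variables (p q : M) (c : R -> M) (D : set (R * R)).
Let G (z : R * R) := phi z.1 (c z.2).
Hypothesis GD : forall z, D z -> [/\ S (c z.2), dom q (G z) & {for z, continuous G}].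
Hypothesis sG : smooth_on D (coord q \o G).

Lemma flow_variation_time z : D z ->
  'D_((1, 0) : R * R) (coord q \o G) z = field_in q X ((coord q \o G) z).
Proof.
case: z => t s Dz; have [Sc qz cG] := GD Dz; have [_ _ _ _ vel] := flow.
have := @velocity_line _ D q G (0, s) (1, 0) t; rewrite line1 => /(_ Dz cG qz sG).
have -> : (fun h : R => G ((0, s) + h *: (1, 0))) = (fun h : R => phi h (c s)).
  by apply/funext => h; rewrite line1.
rewrite vel// => E; rewrite /field_in /= coordK// [X _]E /G /=.
by rewrite tvecK.
Qed.

(** The s-partial represents, in the fixed chart q, the image of c'(0) under the flow at time t. *)
Lemma flow_variation_space t : D (t, 0) ->
  velocity (phi t \o c) 0 =
  tvec q (G (t, 0)) ('D_((0, 1) : R * R) (coord q \o G) (t, 0)).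
Proof.
move=> Dz; have [Sc qz cG] := GD Dz.
have := @velocity_line _ D q G (t, 0) (0, 1) 0; rewrite line2 => /(_ Dz cG qz sG) <-.
by congr (velocity _ 0); apply/funext => h; rewrite line2.
Qed.

(** The curve s -> phi t (c s) stays in S, hence in a level of F, so its velocity is annihilated by
    dF. *)
Lemma flow_variation_level (F : M -> R) (a t : R) : smooth_fun F ->
  S `<=` [set x | F x = a] -> open D -> D (t, 0) ->
  'd (F \o param q) (coord q (G (t, 0)))
    ('D_((0, 1) : R * R) (coord q \o G) (t, 0)) = 0.
Proof.
move=> smF SL oD Dz; have [Sc qz cG] := GD Dz; have [inS _ _ _ _] := flow.
pose y (h : R) : (R * R)%type := (t, 0) + h *: (0, 1).
have y0 : y 0 = (t, 0) by rewrite /y line2.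
have cy : {for (0 : R), continuous y}.
  by apply: cvgD; [exact: cvg_cst|apply: cvgZr_tmp; exact: cvg_id].
have dy : differentiable y (0 : R).
  by apply: differentiableD; [exact: differentiable_cst|exact: differentiableZl].
rewrite -y0 in Dz qz cG *.
rewrite -(derive_line (coord q \o G) (t, 0) (0, 1) 0).
apply: (dfun_level smF (c := G \o y) (a := a)) => //.
- exact: (continuous_comp cy cG).
- apply: (differentiable_comp (g := coord q \o G) dy).
  exact: smooth_differentiable sG Dz.
- have nD : nbhs (y 0) D by exact: open_nbhs_nbhs.
  have H : nbhs (0 : R) (y @^-1` D) by exact: (cy _ nD).
  apply: filterS H => h /GD [Sh _ _].
  by apply: SL; exact: inS.
Qed.

End OnDomain.

End FlowVariation.

Lemma restrict_time (R : realType) (V : normedModType R) (K : (R * R)%type -> V)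
    (t : R) : differentiable K (t, 0) ->
  differentiable (fun s => K (s, 0)) t /\
  'D_1 (fun s => K (s, 0)) t = 'D_((1, 0) : R * R) K (t, 0).
Proof.
move=> dK.
have E : (fun s => K (s, 0)) = K \o (fun s : R => (0, 0) + s *: ((1, 0) : R * R)).
  by apply/funext => s /=; rewrite line1.
have dl : differentiable (fun s : R => (0, 0) + s *: ((1, 0) : R * R)) t.
  by apply: differentiableD; [exact: differentiable_cst|exact: differentiableZl].
split; first by rewrite E; apply: differentiable_comp => //; rewrite line1.
by rewrite E (derive_line K) line1.
Qed.

(** * The variational equation *)

Section VariationEquation.
Context {R : realType} {n : nat} {M : manifold R n}.
Variables (X : M -> 'rV[R]_n) (S : set M) (phi : R -> M -> M).
Hypotheses (smX : smooth_field setT X) (flow : flow_on S X phi).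
Variables (q : M) (c : R -> M) (D : set (R * R)) (oD : open D).
Let G (z : R * R) := phi z.1 (c z.2).
Hypothesis GD : forall z, D z -> [/\ S (c z.2), dom q (G z) & {for z, continuous G}].
Hypothesis sG : smooth_on D (coord q \o G).

Lemma field_in_differentiable x : dom q x -> differentiable (field_in q X) (coord q x).
Proof.
by move=> qx; apply: (smooth_differentiable (smX q)); exists x.
Qed.

(** The mixed partials are exchanged, and the flow equation, valid on all of D, is then
    differentiated in s by the chain rule. *)
Lemma flow_variation_swap z : D z ->
  'D_((1, 0) : R * R) ('D_((0, 1) : R * R) (coord q \o G)) z =
  'D_('D_((0, 1) : R * R) (coord q \o G) z) (field_in q X) (coord q (G z)).
Proof.
move=> Dz; have [_ qz _] := GD Dz; have dH := smooth_differentiable sG Dz.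
apply: (etrans (derive_swap_rV _ _ oD Dz (sG 2))).
have N : \forall y \near z,
    (field_in q X \o (coord q \o G)) y = 'D_((1, 0) : R * R) (coord q \o G) y.
  have nD : nbhs z D by exact: open_nbhs_nbhs.
  apply: filterS nD => y Dy.
  exact: (esym (flow_variation_time flow GD sG Dy)).
have dY := field_in_differentiable qz.
apply: (etrans (esym (near_eq_derive _ N))).
apply: (etrans (deriveE _ (differentiable_comp_at erefl dH dY))).
apply: (etrans (diff_comp_at _ erefl dH dY)).
by apply: (etrans _ (esym (deriveE _ dY))); congr ('d _ _ _); rewrite -deriveE.
Qed.

Lemma flow_variation_equation t : D (t, 0) ->
  let v s := 'D_((0, 1) : R * R) (coord q \o G) (s, 0) in
  differentiable v t /\ 'D_1 v t = 'D_(v t) (field_in q X) (coord q (G (t, 0))).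
Proof.
move=> Dt v.
have dv := smooth_differentiable (smooth_derive ((0, 1) : R * R) sG) Dt.
have [d1 d2] := restrict_time dv; split; first exact: d1.
exact: (etrans d2 (flow_variation_swap Dt)).
Qed.

Lemma flow_base_equation t : D (t, 0) ->
  differentiable (fun s => coord q (G (s, 0))) t /\
  'D_1 (fun s => coord q (G (s, 0))) t = field_in q X (coord q (G (t, 0))).
Proof.
move=> Dt; have dH := smooth_differentiable sG Dt.
have [d1 d2] := restrict_time dH; split; first exact: d1.
by apply: (etrans d2); exact: (flow_variation_time flow GD sG Dt).
Qed.

End VariationEquation.

(** * The volume form and its Lie derivative in a chart *)

Section Forms.
Context {R : realType} {M : manifold R 3}.
Variables (Om : M -> 'rV[R]_3 -> 'rV[R]_3 -> 'rV[R]_3 -> R).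
Hypothesis smOm : smooth_3form Om.

Lemma form3_in_alternating q x : dom q x -> alternating3 (form3_in q Om (coord q x)).
Proof.
move=> qx; rewrite /form3_in coordK//; have [lin alt _] := smOm.
split=> v w; last by have [] := alt x (tvec q x v) (tvec q x w).
have [l1 l2 l3] := lin x (tvec q x v) (tvec q x w).
by split=> k y z; rewrite /tvec linearP ?l1 ?l2 ?l3.
Qed.

Lemma form3_in_det q x a b c : dom q x ->
  form3_in q Om (coord q x) a b c = coef3 (form3_in q Om (coord q x)) * det3 a b c.
Proof. by move=> qx; apply: alternating3E; exact: form3_in_alternating. Qed.

Lemma form3_in_tcoord q x a b c : dom q x ->
  Om x a (tvec q x b) (tvec q x c) =
  coef3 (form3_in q Om (coord q x)) * det3 (tcoord q x a) b c.
Proof.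
move=> qx; have := form3_in_det (tcoord q x a) b c qx.
by rewrite {1}/form3_in coordK// tcoordK.
Qed.

Lemma coef3_differentiable q x : dom q x ->
  differentiable (fun u => coef3 (form3_in q Om u)) (coord q x).
Proof.
move=> qx; have [_ _ sm] := smOm.
by apply: (smooth_differentiable (sm q _ _ _)); exists x.
Qed.

(** In the chart the form is a density rho times [det3], so only rho is differentiated along X. The
    point is the center q of the chart, where [lie_derivative3] is defined in these coordinates. *)
Lemma lie_derivative3_in (X : M -> 'rV[R]_3) q a b c :
  let u := coord q q in let Y := field_in q X in
  let rho u := coef3 (form3_in q Om u) in
  lie_derivative3 X Om q a b c = 'd rho u (Y u) * det3 a b c +
    rho u * (det3 ('D_a Y u) b c + det3 a ('D_b Y u) c + det3 a b ('D_c Y u)).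
Proof.
move=> u Y rho; have qq := dom_self q; rewrite /lie_derivative3.
rewrite -/u -/Y !(form3_in_det _ _ _ qq) -/u.
have dr : differentiable rho u := coef3_differentiable qq.
have N : \forall y \near u, rho y * det3 a b c = form3_in q Om y a b c.
  apply: filterS (near_chart qq (@filterT _ _ _)) => _ [y [qy _ <- _]].
  by rewrite form3_in_det.
have -> : 'd (fun u0 => form3_in q Om u0 a b c : R) u (Y u) = 'd rho u (Y u) * det3 a b c.
  have dm : differentiable (fun y => rho y * det3 a b c) u by exact: differentiableZl.
  apply: (etrans (near_eq_diff (Y u) N dm)).
  by rewrite (diffZl (det3 a b c) dr).
rewrite -/(rho u); move: (rho u) ('d rho u (Y u) * det3 a b c).
move: (det3 ('D_a Y u) b c) (det3 a ('D_b Y u) c) (det3 a b ('D_c Y u)).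
by move=> x y z r k; ring.
Qed.

End Forms.

Lemma diff_field_in (R : realType) n (M : manifold R n) (F : M -> R)
    (Z : M -> 'rV[R]_n) (q x : M) : smooth_fun F -> dom q x ->
  'd (F \o param q) (coord q x) (field_in q Z (coord q x)) = dfun F x (Z x).
Proof.
by move=> smF qx; rewrite /field_in coordK// -dfun_tvec// tcoordK.
Qed.

(** * Invariance of the contracted form *)

Section Invariance.
Context {R : realType} {M : manifold R 3}.
Variables (Om : M -> 'rV[R]_3 -> 'rV[R]_3 -> 'rV[R]_3 -> R).
Hypothesis smOm : smooth_3form Om.
Variables (X : M -> 'rV[R]_3) (smX : smooth_field setT X).
Hypothesis divX : divergence_free Om X.
Variables (F : M -> R) (smF : smooth_fun F).
Hypothesis intF : forall p, dfun F p (X p) = 0.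
Variables (a : R) (S : set M) (SL : S `<=` [set x | F x = a]).
Variable n : M -> 'rV[R]_3.
Hypothesis nS : forall q, S q -> exists U : set M,
  [/\ open U, U q, smooth_field U n & forall x, U x -> dfun F x (n x) = 1].
Variables (phi : R -> M -> M) (flow : flow_on S X phi).

Lemma contraction_derivative (p : M) (c1 c2 : R -> M) (t0 : R) : S p ->
  curve_through S p c1 -> curve_through S p c2 ->
  is_derive t0 1 (fun t => Om (phi t p) (n (phi t p))
    (velocity (phi t \o c1) 0) (velocity (phi t \o c2) 0)) 0.
Proof.
move=> Sp h1 h2; have [inS _ _ _ _] := flow.
pose q := phi t0 p; have Sq : S q := inS t0 p Sp.
have qq : dom q q := dom_self q.
have [D1 [oD1 D10 GD1 sG1]] := flow_variation flow Sp h1 qq.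
have [D2 [oD2 D20 GD2 sG2]] := flow_variation flow Sp h2 qq.
have c10 : c1 0 = p by case: h1 => J [].
have c20 : c2 0 = p by case: h2 => J [].
have [U [oU Uq sn n1]] := nS Sq.
pose u0 := coord q q; pose f := F \o param q.
pose Y := field_in q X; pose N := field_in q n.
pose rho u := coef3 (form3_in q Om u).
pose y t := coord q (phi t p).
pose v1 t := 'D_((0, 1) : R * R) (coord q \o (fun z => phi z.1 (c1 z.2))) (t, 0 : R).
pose v2 t := 'D_((0, 1) : R * R) (coord q \o (fun z => phi z.1 (c2 z.2))) (t, 0 : R).
have y0 : y t0 = u0 by [].
have [dv1 ev1] : differentiable v1 t0 /\ 'D_1 v1 t0 = 'D_(v1 t0) Y u0.
  by have := flow_variation_equation smX flow oD1 GD1 sG1 D10; rewrite /= c10.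
have [dv2 ev2] : differentiable v2 t0 /\ 'D_1 v2 t0 = 'D_(v2 t0) Y u0.
  by have := flow_variation_equation smX flow oD2 GD2 sG2 D20; rewrite /= c20.
have [dy ey] : differentiable y t0 /\ 'D_1 y t0 = Y u0.
  by have := flow_base_equation flow GD1 sG1 D10; rewrite /= c10.
have l1 : 'd f u0 (v1 t0) = 0.
  by have := flow_variation_level flow GD1 sG1 smF SL oD1 D10; rewrite /= c10.
have l2 : 'd f u0 (v2 t0) = 0.
  by have := flow_variation_level flow GD2 sG2 smF SL oD2 D20; rewrite /= c20.
have dY : differentiable Y u0 := field_in_differentiable smX qq.
have dN : differentiable N u0 by apply: (smooth_differentiable (sn q)); exists q.
have drho : differentiable rho u0 := coef3_differentiable smOm qq.
(* For t near t0 everything is expressed in the one chart at q = phi t0 p, where the product rule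
   can be applied. *)
have E : \forall t \near t0, rho (y t) * det3 (N (y t)) (v1 t) (v2 t) =
    Om (phi t p) (n (phi t p)) (velocity (phi t \o c1) 0) (velocity (phi t \o c2) 0).
  have near0 (D : set (R * R)%type) : open D -> D (t0, 0) -> \forall t \near t0, D (t, 0).
    move=> oD D0.
    pose i (t : R) : (R * R)%type := (t, 0).
    have ci : {for t0, continuous i}.
      apply: differentiable_continuous.
      by apply: differentiable_pair; [exact: ex_diff|exact: differentiable_cst].
    have Di : D (i t0) by exact: D0.
    have nD : nbhs (i t0) D by exact: open_nbhs_nbhs.
    exact: (ci _ nD).
  apply: filterS2 (near0 _ oD1 D10) (near0 _ oD2 D20) => t Dt1 Dt2.
  rewrite (flow_variation_space GD1 sG1 Dt1) (flow_variation_space GD2 sG2 Dt2).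
  have [_ qt _] := GD1 _ Dt1; rewrite /= c10 in qt; rewrite /= c10 c20.
  by rewrite (form3_in_tcoord smOm _ _ _ qt) /N /field_in coordK.
have dNy : differentiable (N \o y) t0 := differentiable_comp_at y0 dy dN.
have eNy : 'D_1 (N \o y) t0 = 'D_(Y u0) N u0.
  apply: (etrans (deriveE _ dNy)); apply: (etrans (diff_comp_at _ y0 dy dN)).
  by apply: (etrans _ (esym (deriveE _ dN))); congr ('d _ _ _); rewrite -deriveE.
have dry : differentiable (rho \o y) t0 := differentiable_comp_at y0 dy drho.
have ery : 'D_1 (rho \o y) t0 = 'd rho u0 (Y u0).
  apply: (etrans (deriveE _ dry)); apply: (etrans (diff_comp_at _ y0 dy drho)).
  by congr ('d _ _ _); rewrite -deriveE.
have i1 : is_derive t0 1 (rho \o y) ('d rho u0 (Y u0)).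
  by apply: DeriveDef ery; exact: diff_derivable.
have i2 := is_derive_det3 dNy dv1 dv2.
rewrite eNy ev1 ev2 in i2.
apply: (near_eq_is_derive E); apply: is_derive_eq (is_deriveM i1 i2) _.
(* By [br] and [K], D_Y n may be replaced by D_n Y, which occurs in L_X Om. *)
have br : 'd f u0 ('D_(Y u0) N u0) = 'd f u0 ('D_(N u0) Y u0).
  have oI : open (coord q @` dom q) by exact: cimg_open.
  have Iu : (coord q @` dom q) u0 by exists q.
  have hY : \forall u \near u0, 'd f u (Y u) = 0.
    apply: filterS (near_chart qq (@filterT _ _ _)) => _ [x [qx _ <- _]].
    exact: (etrans (diff_field_in X smF qx) (intF x)).
  have hN : \forall u \near u0, 'd f u (N u) = 1.
    have nU : nbhs q U := open_nbhs_nbhs (conj oU Uq).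
    apply: filterS (near_chart qq nU) => _ [x [qx Ux <- _]].
    exact: (etrans (diff_field_in n smF qx) (n1 x Ux)).
  exact: diff_bracket oI Iu (smF q) dY dN hY hN.
have K : det3 ('D_(Y u0) N u0 - 'D_(N u0) Y u0) (v1 t0) (v2 t0) * rho u0 = 0.
  have sl : scalar ('d f u0) by move=> k z w; rewrite linearP.
  have nz : exists v, 'd f u0 v != 0.
    exists (N u0); have -> : 'd f u0 (N u0) = 1.
      exact: (etrans (diff_field_in n smF qq) (n1 q Uq)).
    exact: oner_neq0.
  have lb : 'd f u0 ('D_(Y u0) N u0 - 'D_(N u0) Y u0) = 0.
    by rewrite linearB br /= subrr.
  rewrite mulrC -(form3_in_det smOm _ _ _ qq).
  exact: (alternating3_ker (form3_in_alternating smOm qq) sl nz lb l1 l2).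
have := divX q (N u0) (v1 t0) (v2 t0).
rewrite mul0r (lie_derivative3_in smOm) -/u0 -/Y -/rho -/(rho u0).
move: K; rewrite /GRing.scale /= y0.
move: ('D_(v1 t0) Y u0) ('D_(v2 t0) Y u0) ('D_(Y u0) N u0) ('D_(N u0) Y u0).
move: (v1 t0) (v2 t0) (N u0) (rho u0) ('d rho u0 (Y u0)).
move=> w1 w2 m r k z1 z2 b1 b2; rewrite /det3 !mxE => K L.
(* The derivative minus L_X Om is exactly the left side of K, a polynomial identity in the
   coordinates. *)
apply: (etrans _ L); apply/eqP; rewrite -subr_eq0; apply/eqP.
by apply: (etrans _ K); ring.
Qed.

End Invariance.

(** The curve picked by [xget] inside [tangent_map] depends on v but not on f, so a single c
    represents the images of v under phi t for all t. For tangent v the default curve is never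
    selected. *)
Lemma curve_tangent_map (R : realType) n (M : manifold R n) (S : set M) (p : M)
    (v : 'rV[R]_n) : tangent S p v -> exists c, [/\ curve_through S p c,
  velocity c 0 = v & forall f, tangent_map S f p v = velocity (f \o c) 0].
Proof.
move=> tv; have [c0 Hc0] := tv.
exists (xget (fun=> p) [set c | curve_through S p c /\ velocity c 0 = v]).
by case: xgetP => [c -> [cS cv]|/(_ c0 Hc0)//]; split.
Qed.
Theorem theorem2 (R : realType) (M : manifold R 3) (orM : oriented M)
    (Om : M -> 'rV[R]_3 -> 'rV[R]_3 -> 'rV[R]_3 -> R) (volOm : volume_form Om)
    (X : M -> 'rV[R]_3) (smX : smooth_field setT X)
    (divX : divergence_free Om X)
    (F : M -> R) (smF : smooth_fun F) (intF : forall p, dfun F p (X p) = 0)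
    (c0 : R) (Sigma : set M)
    (compSigma : component_of [set p | F p = c0] Sigma)
    (cptSigma : compact Sigma)
    (regSigma : forall p, Sigma p -> exists v, dfun F p v != 0)
    (nzX : forall p, Sigma p -> X p != 0)
    (W : set M) (openW : open W) (subW : Sigma `<=` W)
    (g : M -> 'rV[R]_3 -> 'rV[R]_3 -> R) (metg : riemannian_metric W g) :
  exists n : M -> 'rV[R]_3,
    let omega_n := fun p xi eta => Om p (n p) xi eta in
    [/\ smooth_field_along Sigma n,
        forall p, Sigma p ->
          forall xi, tangent Sigma p xi -> g p (n p) xi = 0,
        nondegenerate_on Sigma omega_n &
        forall phi : R -> M -> M, flow_on Sigma X phi ->
          forall t p, Sigma p ->
          forall xi eta, tangent Sigma p xi -> tangent Sigma p eta ->
            pullback2 Sigma (phi t) omega_n p xi eta = omega_n p xi eta].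
Proof.
have [[smOm nzOm] [p0 Fp0 SE]] := (volOm, compSigma).
have SL : Sigma `<=` [set x | F x = c0].
  by rewrite SE; exact: connected_component_sub.
exists (normal_field F g) => omega_n.
have nbhd q : Sigma q -> exists U : set M, [/\ open U, U q, U `<=` W &
    forall x, U x -> exists v, dfun F x v != 0].
  move=> Sq; exact: (regular_neighborhood smF openW (subW q Sq) (regSigma q Sq)).
have n1 x : W x -> (exists v, dfun F x v != 0) -> dfun F x (normal_field F g x) = 1.
  move=> Wx nz.
  exact: (normal_vec1 (metric_inner_product metg Wx) (@dfun_scalar _ _ _ F x) nz).
have nS q : Sigma q -> exists U : set M, [/\ open U, U q,
    smooth_field U (normal_field F g) & forall x, U x -> dfun F x (normal_field F g x) = 1].
  move=> /nbhd[U [oU Uq UW nz]]; exists U; split=> //.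
    exact: (smooth_normal_field smF metg oU UW nz).
  by move=> x Ux; apply: n1 (UW _ Ux) (nz _ Ux).
split.
- move=> q /nS[U [oU Uq sU _]]; exists U, (normal_field F g).
  by split.
- move=> p Sp xi txi.
  exact: (normal_vec_orthogonal (metric_inner_product metg (subW p Sp))
    (@dfun_scalar _ _ _ F p) (regSigma p Sp) (tangent_dfun smF SL txi)).
- apply: (normal_contraction_nondegenerate volOm smF compSigma) => p Sp.
  exact: n1 (subW p Sp) (regSigma p Sp).
- move=> phi flow t p Sp xi eta /curve_tangent_map[c1 [h1 v1 E1]] /curve_tangent_map[c2 [h2 v2 E2]].
  have [_ phi0 _ _ _] := flow.
  (* The derivative vanishes at every t0, so the value at time t equals the value at time 0. *)
  have C := is_derive_0_is_cst t 0 (fun t0 => contraction_derivative smOm smX divX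
    smF intF SL nS flow t0 Sp h1 h2).
  rewrite /pullback2 E1 E2 /omega_n.
  apply: (etrans C); rewrite /= phi0//.
  (* The map phi 0 is the identity on Sigma only, but c stays in Sigma near 0, which is all the
     velocity at 0 depends on. *)
  have V c v : curve_through Sigma p c -> velocity c 0 = v -> velocity (phi 0 \o c) 0 = v.
    move=> [J [oJ J0 _ c0E cS]] <-; rewrite /velocity !derive1E /= phi0; last exact: cS.
    apply: near_eq_derive; have nJ : nbhs (0 : R) J by exact: open_nbhs_nbhs.
    by apply: filterS nJ => s Js; rewrite /= phi0//; exact: cS.
  by rewrite (V _ _ h1 v1) (V _ _ h2 v2).
Qed.
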